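(* Under hypotheses (A) and (B), the essential spectral radius $r_e^*$ of the Jackson network process satisfies $$-\min_{1\le i\le d}\frac{1}{G_{ii}}\bigl(\sqrt{\mu_i}-\sqrt{\nu_i}\bigr)^2\le\log r_e^*.$$
   Context: Jackson network with $d$ queues: arrival rates $\lambda_i\ge0$, service rates $\mu_i>0$, routing matrix $P=(p_{ij})_{i,j=1}^d$ nonnegative with $p_{ii}=0$, $\sum_jp_{ij}\le1$, $p_{i0}=1-\sum_jp_{ij}$. The queue-length process $(Z(t))$ is the continuous-time Markov process on $\mathbb{Z}_+^d$ with jumps $+\epsilon^i$ at rate $\lambda_i$, $-\epsilon^i$ at rate $\mu_ip_{i0}$, $\epsilon^j-\epsilon^i$ at rate $\mu_ip_{ij}$ (jumps that would leave $\mathbb{Z}_+^d$ are suppressed). Hypothesis (A): the kernel $(q(x-y))_{x,y\in\mathbb{Z}^d}$ of these jump rates is irreducible (equivalently: spectral radius of $P$ $<1$, and for every $i$ there are $n,j$ with $\lambda_jp^{(n)}_{ji}>0$). Traffic equations $\nu_j=\lambda_j+\sum_i\nu_ip_{ij}$ then have a unique solution with $\nu_i>0$. Hypothesis (B): $\nu_i<\mu_i$ for all $i$. $G=(I-P)^{-1}$. For finite $E\subset\mathbb{Z}_+^d$ let $\tau_E=\inf\{t>0:Z(t)\in E\}$. The essential spectral radius $r_e^*$ is the infimum of all $r>0$ for which there is a finite $E\subset\mathbb{Z}_+^d$ with $\int_0^\infty r^{-t}\mathbb{P}_x(Z(t)=y,\tau_E>t)\,dt<\infty$ for all $x,y\in\mathbb{Z}_+^d\setminus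 E$. *)

(* Defs.v *)
From HB Require Import structures.
From mathcomp Require Import all_boot all_order all_algebra.
From mathcomp Require Import all_classical all_reals all_analysis.
Set Implicit Arguments. Unset Strict Implicit. Unset Printing Implicit Defensive.
Import Order.TTheory GRing.Theory Num.Theory.
Import numFieldNormedType.Exports.
Local Open Scope classical_set_scope.
Local Open Scope ring_scope.

Section Jackson.
Variables (R : realType) (d : nat).
Variables (lam mu : 'I_d -> R) (P : 'M[R]_d).

Definition p0 (i : 'I_d) : R := 1 - \sum_(j < d) P i j.

Definition eZ (i : 'I_d) : 'rV[int]_d := delta_mx 0 i.

Definition qZ (z : 'rV[int]_d) : R :=
  \sum_(i < d) ( lam i * (z == eZ i)%:R
               + mu i * p0 i * (z == - eZ i)%:R
               + \sum_(j < d | j != i) mu i * P i j * (z == eZ j - eZ i)%:R ).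

Definition irreducible_q : Prop :=
  forall x y : 'rV[int]_d, exists s : seq 'rV[int]_d,
    path [rel a b | 0 < qZ (b - a)] x s /\ last x s = y.

Definition state := {ffun 'I_d -> nat}.

Definition up (x : state) (i : 'I_d) : state := [ffun k => x k + (k == i)]%N.
Definition down (x : state) (i : 'I_d) : state := [ffun k => x k - (k == i)]%N.

(* jump rate from x to y (y <> x); suppressed jumps (leaving Z_+^d) get rate 0 *)
Definition jrate (x y : state) : R :=
  \sum_(i < d) ( lam i * (y == up x i)%:R
               + (0 < x i)%N%:R * mu i * p0 i * (y == down x i)%:R
               + \sum_(j < d | j != i)
                   (0 < x i)%N%:R * mu i * P i j * (y == up (down x i) j)%:R ).

Definition out_rate (x : state) : R :=
  \sum_(i < d) ( lam i + (0 < x i)%N%:R * mu i * (p0 i + \sum_(j < d | j != i) P i j) ).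

(* uniformization constant, a bound on all out rates *)
Definition Lam : R := \sum_(i < d) (lam i + mu i).

(* one-step kernel of the uniformized (embedded discrete-time) chain *)
Definition Kone (x y : state) : R :=
  jrate x y / Lam + (y == x)%:R * (1 - out_rate x / Lam).

Definition succ (x : state) : seq state :=
  undup (x :: [seq up x i | i <- enum 'I_d] ++ [seq down x i | i <- enum 'I_d]
           ++ [seq up (down x i) j | i <- enum 'I_d, j <- enum 'I_d]).

(* n-step kernel of the uniformized chain killed when entering E (steps 1..n) *)
Fixpoint Kkill (E : seq state) (n : nat) (x y : state) : R :=
  match n with
  | 0 => (x == y)%:R
  | n'.+1 => \sum_(z <- succ x | z \notin E) Kone x z * Kkill E n' z y
  end.

(* P_x(Z(t) = y, tau_E > t) for the continuous-time chain (constructed by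
   uniformization: Z(t) = Y_{N(t)}, N a Poisson process of rate Lam) *)
Definition ptkill (E : seq state) (t : R) (x y : state) : \bar R :=
  (\sum_(n <oo) (expR (- (Lam * t)) * (Lam * t) ^+ n / n`!%:R
                 * Kkill E n x y)%:E)%E.

Definition ess_set : set R :=
  [set r : R | 0 < r /\ exists E : seq state, forall x y : state,
      x \notin E -> y \notin E ->
      (\int[lebesgue_measure]_(t in `[0%R, +oo[%classic)
          ((r `^ (- t))%:E * ptkill E t x y) < +oo)%E].

Definition ess_spec_radius : \bar R := ereal_inf [set r%:E | r in ess_set].

Definition traffic (nu : 'I_d -> R) : Prop :=
  forall j, nu j = lam j + \sum_(i < d) nu i * P i j.

Definition Gmx : 'M[R]_d := invmx (1%:M - P).

End Jackson.

(* Main.v *)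
Require Import Defs.
From HB Require Import structures.
From mathcomp Require Import all_boot all_order all_algebra.
From mathcomp Require Import all_classical all_reals all_analysis measurable_realfun.
From mathcomp Require Import ring lra zify.
Set Implicit Arguments. Unset Strict Implicit. Unset Printing Implicit Defensive.
Import Order.TTheory GRing.Theory Num.Theory.
Import numFieldNormedType.Exports.
Local Open Scope ring_scope.

(** Let [i] minimise [c_i = (sqrt mu_i - sqrt nu_i)^2 / G_ii]. Far out along the [i]-th
    axis the network does not see [E] and queue [i] is never empty, so it behaves like
    the free network on [Z x Z_+^(d-1)] in which server [i] never idles. With
    [alpha = sqrt (mu_i / nu_i)], the monomial with weights
    [alpha_j = 1 + (alpha - 1) G_ji / G_ii] is an eigenfunction of the free generator for
    [- c_i], and for every [t > 0] the monomial with weights [u_j(t) / mu_j], where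
    [u_j(t) = nu_j + (t sqrt (mu_i nu_i) - nu_i) G_ij / G_ii], is an eigenmeasure whose
    eigenvalue is minimal, equal to [- c_i], at [t = 1].  Minimality of [c_i] gives
    [u_j(1) alpha_j < mu_j] for [j <> i]. Varying [t] around [1], the eigenmeasures
    bound the mass that the tilted chain carries outside a ball of radius [n / l] after
    [n] steps by an exponentially small quantity (a Chernoff bound). If the return
    probabilities to the origin decayed faster than [exp (- c_i t)], then, since
    every point of the ball reaches the origin at a cost exponential in its norm, the mass
    inside the ball would be exponentially small too, contradicting conservation
    of the tilted mass. *)

(** * Transience of the routing chain *)

Section Routing.
Variables (R : realType) (d : nat) (lam mu : 'I_d -> R) (P : 'M[R]_d).
Hypotheses (lam_ge0 : forall j, 0 <= lam j) (mu_gt0 : forall j, 0 < mu j).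
Hypotheses (P_ge0 : forall j k, 0 <= P j k).
Hypothesis P_sub : forall j, \sum_(k < d) P j k <= 1.

Lemma p0_ge0 j : 0 <= p0 P j.
Proof. by rewrite /p0 subr_ge0. Qed.

Lemma qZ_gt0 (z : 'rV[int]_d) : 0 < qZ lam mu P z ->
  [\/ exists2 j, 0 < lam j & z = eZ j,
      exists2 j, 0 < p0 P j & z = - eZ j |
      exists j k, 0 < P j k /\ z = eZ k - eZ j].
Proof.
move=> qz; apply: contrapT => H.
have {H}[H1 H2 H3] : [/\ ~ (exists2 j, 0 < lam j & z = eZ j),
   ~ (exists2 j, 0 < p0 P j & z = - eZ j) &
   ~ exists j k, 0 < P j k /\ z = eZ k - eZ j].
  by split=> ?; apply: H; [exact: Or31 | exact: Or32 | exact: Or33].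
have weight0 (x : R) (b : bool) : 0 <= x -> (b -> ~ 0 < x) -> x * b%:R = 0.
  case: b => x0 /= nx; last by rewrite mulr0.
  by rewrite mulr1; apply/eqP; apply: contrapT => x_neq0; apply: nx => //;
    rewrite lt_neqAle x0 eq_sym andbT; apply/negP.
suff q0 : qZ lam mu P z = 0 by rewrite q0 ltxx in qz.
rewrite /qZ big1 // => j _.
rewrite weight0 ?weight0 ?add0r ?big1 //.
- move=> k _; rewrite weight0 // ?mulr_ge0 ?(ltW (mu_gt0 _)) // => /eqP zE.
  by rewrite pmulr_rgt0 // => Pjk; apply: H3; exists j, k.
- by rewrite mulr_ge0 ?p0_ge0 ?(ltW (mu_gt0 _)).
- by move=> /eqP zE; rewrite pmulr_rgt0 // => pj; apply: H2; exists j.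
- by move=> /eqP zE lj; apply: H1; exists j.
Qed.

Hypothesis irr : irreducible_q lam mu P.

Let mass (S : {set 'I_d}) (z : 'rV[int]_d) : int := \sum_(j in S) z 0 j.

Let massD S (y z : 'rV[int]_d) : mass S (y + z) = mass S y + mass S z.
Proof. by rewrite /mass -big_split; apply: eq_bigr => j _; rewrite mxE. Qed.

Let massN S (z : 'rV[int]_d) : mass S (- z) = - mass S z.
Proof. by rewrite /mass -sumrN; apply: eq_bigr => j _; rewrite mxE. Qed.

Let mass_eZ (S : {set 'I_d}) j : mass S (eZ j) = (j \in S)%:R.
Proof.
rewrite /mass (eq_bigr (fun k => (k == j)%:R)); last by move=> k _; rewrite !mxE.
have [jS|jS] := boolP (j \in S).
  rewrite (bigD1 j) //= eqxx big1 ?addr0 // => k /andP[_ /negbTE->//].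
by rewrite big1 // => k kS; case: eqP => // kj; rewrite -kj kS in jS.
Qed.


(** A linear functional that no jump of positive rate decreases stays nonnegative along paths from
    the origin, and by irreducibility such paths end everywhere. *)
Let mass_mono (c : int) (S : {set 'I_d}) :
  (forall z, 0 < qZ lam mu P z -> 0 <= c * mass S z) -> forall z, 0 <= c * mass S z.
Proof.
move=> qS z; have [s [ps <-]] := irr 0 z.
have : 0 <= c * mass S 0 by rewrite /mass big1 ?mulr0 // => j _; rewrite mxE.
elim: s (0 : 'rV[int]_d) ps => //= y s IHs x /andP[qyx ps] x0; apply: IHs => //.
by rewrite -(subrK x y) massD mulrDr addr_ge0 // qS.
Qed.

(** If no customer could leave [S], its total content would never decrease, yet irreducibility leads
    from the origin to [- eZ j0]. *)
Lemma no_absorbing_set (S : {set 'I_d}) j0 : j0 \in S ->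
  exists2 j, j \in S & 0 < p0 P j \/ exists2 k, k \notin S & 0 < P j k.
Proof.
move=> j0S; apply: contrapT => H.
suff /mass_mono/(_ (- eZ j0)) : forall z, 0 < qZ lam mu P z -> 0 <= 1 * mass S z.
  by rewrite massN mass_eZ j0S.
move=> z /qZ_gt0[[j _ ->]|[j pj ->]|[j [k [Pjk ->]]]]; rewrite mul1r.
- by rewrite mass_eZ; case: (j \in S).
- rewrite massN mass_eZ; case: (boolP (j \in S)) => //= jS.
  by case: H; exists j => //; left.
- rewrite massD massN !mass_eZ.
  have [jS|] := boolP (j \in S); last by case: (k \in S).
  have [//|kS] := boolP (k \in S).
  by case: H; exists j => //; right; exists k.
Qed.

(** Mirror image: a set fed neither from outside nor from its complement never gains a customer, yet
    [eZ j0] is reachable. *)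
Lemma no_isolated_set (S : {set 'I_d}) j0 : j0 \in S ->
  exists2 j, j \in S & 0 < lam j \/ exists2 k, k \notin S & 0 < P k j.
Proof.
move=> j0S; apply: contrapT => H.
suff /mass_mono/(_ (eZ j0)) : forall z, 0 < qZ lam mu P z -> 0 <= -1 * mass S z.
  by rewrite mass_eZ j0S.
move=> z /qZ_gt0[[j lj ->]|[j _ ->]|[k [j [Pkj ->]]]]; rewrite mulN1r.
- rewrite mass_eZ; case: (boolP (j \in S)) => //= jS.
  by case: H; exists j => //; left.
- by rewrite massN mass_eZ; case: (j \in S).
- rewrite massD massN !mass_eZ.
  have [jS|] := boolP (j \in S); last by case: (k \in S).
  have [//|kS] := boolP (k \in S).
  by case: H; exists j => //; right; exists k.
Qed.

(** Maximum principle with boundary [B]. Where a positive maximum is attained, [no_absorbing_set]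
    finds a node leaking to the exterior or to a smaller value, and there subharmonicity fails. *)
Lemma subharmonic_le0 (B : pred 'I_d) (f : 'I_d -> R) :
  (forall j, ~~ B j -> f j <= \sum_(k < d) P j k * f k) ->
  (forall j, B j -> f j <= 0) -> forall j, f j <= 0.
Proof.
move=> fP fB j0; rewrite leNgt; apply/negP => fj0.
have [jm _ fmax] := @arg_maxP _ R 'I_d j0 predT f isT.
have fjm k : f k <= f jm by exact: fmax.
have [|j] := @no_absorbing_set [set j | f j == f jm] jm; first by rewrite inE.
have M_gt0 : 0 < f jm by apply: lt_le_trans (fjm j0).
rewrite inE => /eqP fj; case=> [pj|[k]].
  have nB : ~~ B j by apply/negP => /fB; rewrite fj leNgt M_gt0.
  have : f j <= (1 - p0 P j) * f jm.
    rewrite /p0 opprB addrC subrK mulr_suml; apply: le_trans (fP j nB) _.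
    by apply: ler_sum => k _; rewrite ler_wpM2l // fjm.
  by rewrite fj mulrBl mul1r lerBrDr gerDl leNgt mulr_gt0.
rewrite inE => fk Pjk.
have nB : ~~ B j by apply/negP => /fB; rewrite fj leNgt M_gt0.
have : 0 < \sum_(l < d) P j l * (f jm - f l).
  rewrite (bigD1 k) //= ltr_pwDl //.
    by rewrite mulr_gt0 // subr_gt0 lt_neqAle fk fjm.
  by apply: sumr_ge0 => l _; rewrite mulr_ge0 // subr_ge0 fjm.
rewrite (eq_bigr (fun l => P j l * f jm - P j l * f l)); last by move=> *; rewrite mulrBr.
rewrite sumrB -mulr_suml subr_gt0 => /(le_lt_trans (fP j nB)).
by rewrite fj -[X in X < _]mul1r ltr_pM2r // ltNge P_sub.
Qed.

Lemma routing_unitmx : 1%:M - P \in unitmx.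
Proof.
rewrite -unitmx_tr -row_free_unit; apply/inj_row_free => v.
move=> /(congr1 trmx); rewrite trmx_mul trmxK trmx0 => vP.
apply: trmx_inj; rewrite trmx0; set u := v^T in vP *.
have harm j : u j 0 = \sum_(k < d) P j k * u k 0.
  have /matrixP/(_ j 0) := vP; rewrite mulmxBl mul1mx !mxE => /eqP.
  by rewrite subr_eq0 => /eqP.
apply/matrixP => j l; rewrite ord1 [RHS]mxE; apply/eqP; rewrite eq_le; apply/andP; split.
  by apply: (@subharmonic_le0 pred0 (fun j => u j 0)) => // m _; rewrite -harm.
rewrite -oppr_le0; apply: (@subharmonic_le0 pred0 (fun j => - u j 0)) => // m _.
by rewrite harm -sumrN ler_sum // => k _; rewrite mulrN.
Qed.

Local Notation G := (Gmx P).

Lemma Gmx_recl j k : G j k = (j == k)%:R + \sum_(l < d) P j l * G l k.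
Proof.
have /matrixP/(_ j k) := mulmxV routing_unitmx.
by rewrite mulmxBl mul1mx !mxE => /eqP; rewrite subr_eq => /eqP.
Qed.

Lemma Gmx_recr j k : G j k = (j == k)%:R + \sum_(l < d) G j l * P l k.
Proof.
have /matrixP/(_ j k) := mulVmx routing_unitmx.
by rewrite mulmxBr mulmx1 !mxE => /eqP; rewrite subr_eq => /eqP.
Qed.

Lemma Gmx_ge0 j k : 0 <= G j k.
Proof.
rewrite -oppr_le0; apply: (@subharmonic_le0 pred0 (fun j => - G j k)) => // l _.
rewrite Gmx_recl opprD -sumrN; apply: (@le_trans _ _ (\sum_(m < d) - (P l m * G m k))).
  by rewrite gerDr oppr_le0 ler0n.
by apply: ler_sum => m _; rewrite mulrN.
Qed.

Lemma Gmx_diag_ge1 j : 1 <= G j j.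
Proof.
by rewrite Gmx_recl eqxx lerDl; apply: sumr_ge0 => k _; rewrite mulr_ge0 ?Gmx_ge0.
Qed.

Lemma Gmx_diag_gt0 j : 0 < G j j.
Proof. exact: lt_le_trans ltr01 (Gmx_diag_ge1 j). Qed.

(** [G j k / G k k] is the probability of ever visiting [k] from [j]; the maximum principle with
    boundary [k] bounds it by [1]. *)
Lemma Gmx_le_diag j k : G j k <= G k k.
Proof.
rewrite -subr_le0; apply: (@subharmonic_le0 (pred1 k) (fun j => G j k - G k k)).
  move=> l /= lk; rewrite Gmx_recl (negbTE lk) add0r.
  under [X in _ <= X]eq_bigr do rewrite mulrBr.
  rewrite sumrB lerB // -mulr_suml -[X in _ <= X]mul1r ler_wpM2r ?Gmx_ge0 //.
by move=> _ /eqP->; rewrite subrr.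
Qed.

(* Passing through [j] on the way to [k] can only lower the chance of hitting [k]. *)
Lemma Gmx_through i j k : G k j * G j i <= G k i * G j j.
Proof.
rewrite -subr_le0.
apply: (@subharmonic_le0 (pred1 j) (fun k => G k j * G j i - G k i * G j j)).
  move=> l /= lj; rewrite (Gmx_recl l j) (negbTE lj) add0r (Gmx_recl l i) mulrDl opprD.
  under [X in _ <= X]eq_bigr do rewrite mulrBr !mulrA.
  rewrite sumrB !mulr_suml addrCA gerDr oppr_le0 mulr_ge0 ?Gmx_ge0 //.
by move=> _ /eqP->; rewrite mulrC subrr.
Qed.

(** Equality at [i] would make the difference in [Gmx_through] vanish from every starting node. The
    recursions for [G i i] and [G i j] differ by a Kronecker term, which would then force
    [G j j = 0]. *)
Lemma Gmx_minor_gt0 i j : i != j -> G i j * G j i < G i i * G j j.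
Proof.
move=> ij; rewrite lt_neqAle Gmx_through andbT; apply/eqP => Gij.
have phi0 k : 0 <= G k j * G j i - G k i * G j j.
  rewrite -oppr_le0; apply: (@subharmonic_le0 (pred1 i)
    (fun k => - (G k j * G j i - G k i * G j j))); last first.
    by move=> _ /eqP->; rewrite Gij subrr oppr0.
  move=> l /= li; rewrite (Gmx_recl l i) (negbTE li) add0r (Gmx_recl l j) mulrDl.
  under [X in _ <= X]eq_bigr do rewrite opprB mulrBr !mulrA.
  by rewrite sumrB !mulr_suml opprB opprD addrCA gerDr oppr_le0 mulr_ge0 ?Gmx_ge0.
have phiE k : G k j * G j i = G k i * G j j.
  by apply/eqP; rewrite eq_le Gmx_through -subr_ge0 phi0.
have := phiE i; rewrite (Gmx_recl i i) (Gmx_recl i j) eqxx (negbTE ij) add0r mulrDl.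
rewrite !mulr_suml (eq_bigr (fun l => P i l * G l i * G j j)); last first.
  by move=> l _; rewrite -!mulrA phiE.
have := Gmx_diag_gt0 j; rewrite mulr1n mul1r; set X := \sum_(_ < _) _; lra.
Qed.

Section Traffic.
Variable nu : 'I_d -> R.
Hypothesis nuP : traffic lam P nu.

Lemma trafficE j : nu j = \sum_(k < d) lam k * G k j.
Proof.
pose r (f : 'I_d -> R) : 'rV[R]_d := \row_k f k.
have nuE : r nu *m (1%:M - P) = r lam.
  apply/rowP => k; rewrite mulmxBr mulmx1 !mxE [nu k in LHS]nuP.
  by rewrite [X in _ - X](eq_bigr (fun l => nu l * P l k)) ?addrK // => l _; rewrite mxE.
have /rowP/(_ j) : r nu = r lam *m G by rewrite -nuE mulmxK // routing_unitmx.
by rewrite !mxE => ->; apply: eq_bigr => k _; rewrite mxE.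
Qed.

(** Otherwise the nodes without flow would form a set excluded by [no_isolated_set]. *)
Lemma traffic_gt0 j : 0 < nu j.
Proof.
have nu_ge0 k : 0 <= nu k.
  by rewrite trafficE sumr_ge0 // => l _; rewrite mulr_ge0 ?Gmx_ge0.
rewrite lt_neqAle nu_ge0 andbT eq_sym; apply/negP => nuj.
have [|k] := @no_isolated_set [set k | nu k == 0] j; first by rewrite inE.
rewrite inE nuP => /eqP nuk; case=> [lk|[l nul Plk]].
  suff : 0 < lam k + \sum_(l < d) nu l * P l k by rewrite nuk ltxx.
  by rewrite ltr_pwDl // sumr_ge0 // => l _; rewrite mulr_ge0.
suff : 0 < lam k + \sum_(l < d) nu l * P l k by rewrite nuk ltxx.
rewrite (bigD1 l) //= addrA ltr_pwDl ?sumr_ge0 //; last by move=> m _; rewrite mulr_ge0.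
rewrite ltr_wpDl // mulr_gt0 // lt_neqAle nu_ge0 andbT eq_sym.
by move: nul; rewrite inE.
Qed.

(** This is [Gmx_through] averaged over the arrival rates. *)
Lemma traffic_through i j : nu i * G i j <= nu j * G i i.
Proof.
rewrite !trafficE !mulr_suml; apply: ler_sum => k _.
by rewrite -!mulrA ler_wpM2l // Gmx_through.
Qed.
End Traffic.
End Routing.

(** * Jump kernels *)

Section JumpOperator.
Variables (R : realDomainType) (W : zmodType) (A : finType).
Variables (w : A -> W -> R) (v : A -> W).

Definition jump_op (f : W -> R) (x : W) : R := \sum_a w a x * f (x + v a).

(** Weights stay unnormalised: for rates with sum [Lam] at every point, this is [Lam ^+ n] times a
    transition probability. *)
Definition jump_ker (n : nat) (x y : W) : R :=
  iter n jump_op (fun z => (z == y)%:R) x.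

Lemma iter_jumpS n f x :
  iter n.+1 jump_op f x = \sum_a w a x * iter n jump_op f (x + v a).
Proof. by []. Qed.

Lemma jump_kerS n x y :
  jump_ker n.+1 x y = \sum_a w a x * jump_ker n (x + v a) y.
Proof. by []. Qed.

Lemma eq_iter_jump n f g : f =1 g -> iter n jump_op f =1 iter n jump_op g.
Proof.
move=> fg; elim: n => // n IHn x; rewrite !iter_jumpS.
by apply: eq_bigr => a _; rewrite IHn.
Qed.

Lemma iter_jump_sum (I : Type) (r : seq I) (c : I -> R) (g : I -> W -> R) n x :
  iter n jump_op (fun z => \sum_(b <- r) c b * g b z) x
  = \sum_(b <- r) c b * iter n jump_op (g b) x.
Proof.
elim: n x => // n IHn x; rewrite iter_jumpS.
under eq_bigr do rewrite IHn mulr_sumr.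
rewrite exchange_big /=; apply: eq_bigr => b _; rewrite mulr_sumr.
by apply: eq_bigr => a _; rewrite mulrCA.
Qed.

(** Decomposition by the last jump instead of the first, the form in which eigenmeasures act. *)
Lemma jump_kerSr n x y :
  jump_ker n.+1 x y = \sum_a w a (y - v a) * jump_ker n x (y - v a).
Proof.
rewrite /jump_ker iterSr -iter_jump_sum; apply: eq_iter_jump => z.
apply: eq_bigr => a _; rewrite -subr_eq0 -subr_eq0.
rewrite (_ : z - (y - v a) = z + v a - y); last by rewrite opprB addrA addrAC.
have [/eqP|_] := eqVneq (z + v a - y) 0; last by rewrite !mulr0.
by rewrite subr_eq0 => /eqP <-; rewrite addrK.
Qed.

Lemma iter_jump_eigen (h : W -> R) (V : pred W) (e : R) :
  (forall x, V x -> jump_op h x = e * h x) ->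
  (forall x a, V x -> w a x != 0 -> V (x + v a)) ->
  forall n x, V x -> iter n jump_op h x = e ^+ n * h x.
Proof.
move=> hE hV; elim=> [|n IHn] x Vx; first by rewrite mul1r.
rewrite exprSr -mulrA -hE // mulr_sumr iter_jumpS; apply: eq_bigr => a _.
have [->|wa] := eqVneq (w a x) 0; first by rewrite !mul0r mulr0.
by rewrite IHn ?hV // mulrCA.
Qed.

(* From a point of [V m], [m] jumps cannot leave the finite set [r]. *)
Lemma iter_jump_expand (r : seq W) (V : nat -> pred W) f n x :
  uniq r -> V n x -> (forall y, V 0%N y -> y \in r) ->
  (forall m y a, V m.+1 y -> V m (y + v a)) ->
  iter n jump_op f x = \sum_(y <- r) f y * jump_ker n x y.
Proof.
move=> r_uniq Vx Vr VS; rewrite -iter_jump_sum.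
elim: n x Vx => [|n IHn] x Vx; last first.
  by rewrite !iter_jumpS; apply: eq_bigr => a _; rewrite IHn ?VS.
rewrite /= (bigD1_seq x) ?Vr //= eqxx mulr1 big1 ?addr0 // => y yx.
by rewrite eq_sym (negbTE yx) mulr0.
Qed.

Hypothesis w_ge0 : forall a x, 0 <= w a x.

Lemma jump_ker_ge0 n x y : 0 <= jump_ker n x y.
Proof.
elim: n x => [|n IHn] x; first by rewrite ler0n.
by rewrite jump_kerS sumr_ge0 // => a _; rewrite mulr_ge0 // IHn.
Qed.

Lemma jump_kerD n m x y z :
  jump_ker n x y * jump_ker m y z <= jump_ker (n + m) x z.
Proof.
elim: n x => [|n IHn] x.
  rewrite add0n {1}/jump_ker /=; have [->|_] := eqVneq x y; first by rewrite mul1r.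
  by rewrite mul0r jump_ker_ge0.
rewrite addSn !jump_kerS mulr_suml; apply: ler_sum => a _.
by rewrite -mulrA ler_wpM2l // IHn.
Qed.

Lemma jump_ker1 a x : w a x <= jump_ker 1 x (x + v a).
Proof.
rewrite jump_kerS (bigD1 a) //= eqxx mulr1 lerDl.
by rewrite sumr_ge0 // => b _; rewrite mulr_ge0 ?ler0n.
Qed.

(** Induction on the last jump: [m] dominates the point mass at [x] and is a supersolution of the
    adjoint relation. *)
Lemma jump_ker_le (m : W -> R) (e : R) x :
  0 <= e -> 1 <= m x -> (forall y, 0 <= m y) ->
  (forall y, \sum_a w a (y - v a) * m (y - v a) <= e * m y) ->
  forall n y, jump_ker n x y <= e ^+ n * m y.
Proof.
move=> e0 mx m0 mE; elim=> [|n IHn] y.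
  by rewrite /jump_ker /= mul1r; case: eqP => // <-.
rewrite jump_kerSr exprSr -mulrA; apply: le_trans (_ : _ <= e ^+ n *
    (\sum_a w a (y - v a) * m (y - v a))) _; last by rewrite ler_wpM2l ?exprn_ge0.
by rewrite mulr_sumr; apply: ler_sum => a _; rewrite mulrCA ler_wpM2l.
Qed.
End JumpOperator.

(** * Killed kernels and the Laplace transform *)

Section GammaIntegral.
Local Open Scope classical_set_scope.
Variables (R : realType) (g : R).
Hypothesis g_gt0 : 0 < g.

Lemma cvg_exprn_expRN n : (t ^+ n * expR (- (g * t)) @[t --> +oo] --> (0 : R)).
Proof.
apply: (@squeeze_cvgr _ _ _ _ (cst 0) (fun t => (n.+1)`!%:R / g ^+ n.+1 / t)).
- near=> t.
  have t0 : 0 < t by near: t; apply: nbhs_pinfty_gt; exact: num_real.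
  apply/andP; split; first by rewrite /= mulr_ge0 ?exprn_ge0 ?expR_ge0 ?ltW.
  rewrite ler_pdivlMr // expRN.
  rewrite mulrAC -exprSr ler_pdivrMr ?expR_gt0 // mulrAC ler_pdivlMr ?exprn_gt0 //.
  rewrite -exprMn -ler_pdivrMl ?ltr0n ?fact_gt0 // [X in X <= _]mulrC [t * g]mulrC.
  have gt_ge0 : 0 <= g * t by rewrite mulr_ge0 ?ltW.
  by apply: le_trans (expR_ge1Dxn n gt_ge0); rewrite lerDr.
- exact: cvg_cst.
- rewrite -[X in _ --> X](mulr0 ((n.+1)`!%:R / g ^+ n.+1)).
  apply: cvgM; first exact: cvg_cst.
  by apply/gtr0_cvgV0; [near=> t; near: t; apply: nbhs_pinfty_gt; exact: num_real|exact: cvg_id].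
Unshelve. all: by end_near. Qed.

(** Repeated integration by parts of [expR (- (g * t)) * t ^+ n] divided by the factorial of [n]. *)
Fixpoint gamma_primitive n : R -> R :=
  if n is m.+1 then
    fun t => g^-1 * gamma_primitive m t - (g * (n`!)%:R)^-1 * (t ^+ n * expR (- (g * t)))
  else fun t => - g^-1 * expR (- (g * t)).

Lemma is_derive_gamma_primitive n (t : R) :
  is_derive t 1 (gamma_primitive n) (expR (- (g * t)) * t ^+ n / n`!%:R).
Proof.
have g_neq0 : g != 0 by rewrite gt_eqF.
have dexp : is_derive t 1 (fun t => expR (- (g * t))) (- g * expR (- (g * t))).
  by apply: is_derive_eq; rewrite /GRing.scale /= mulr1 mulrC.
elim: n => [|n IHn] /=.
  apply: is_derive_eq; rewrite /GRing.scale /= mulrA mulrNN mulVf // mul1r.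
  by rewrite expr0 mulr1 fact0 divr1.
move: (gamma_primitive n) IHn => F dF.
have dX : is_derive t 1 (fun t : R => t ^+ n.+1) (n.+1%:R * t ^+ n).
  apply: DeriveDef; first exact: exprn_derivable.
  by rewrite exp_derive /GRing.scale /= mulr1.
have dB := is_deriveB (is_deriveZ g^-1 dF)
  (is_deriveZ (g * n.+1`!%:R)^-1 (is_deriveM dX dexp)).
apply: (is_derive_eq dB); rewrite /GRing.scale /=.
have fn0 : n`!%:R != 0 :> R by rewrite pnatr_eq0 -lt0n fact_gt0.
have n0 : 1 + n%:R != 0 :> R by rewrite nat1r pnatr_eq0.
by rewrite factS natrM exprS; field; rewrite fn0 n0.
Qed.

Lemma cvg_gamma_primitive n : gamma_primitive n t @[t --> +oo] --> 0.
Proof.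
elim: n => [|n IHn] /=.
  rewrite -[X in _ --> X](mulr0 (- g^-1)); apply: cvgM; first exact: cvg_cst.
  by apply: cvg_trans (cvg_exprn_expRN 0); apply: near_eq_cvg; near=> t; rewrite expr0 mul1r.
rewrite -[X in _ --> X]subr0; apply: cvgB.
  by rewrite -[X in _ --> X](mulr0 g^-1); apply: cvgM => //; exact: cvg_cst.
rewrite -[X in _ --> X](mulr0 (g * (n.+1`!)%:R)^-1); apply: cvgM; first exact: cvg_cst.
exact: cvg_exprn_expRN.
Unshelve. all: by end_near. Qed.

Lemma gamma_primitive0 n : gamma_primitive n 0 = - (g ^+ n.+1)^-1.
Proof.
elim: n => [|n IHn] /=; first by rewrite mulr0 oppr0 expR0 mulr1.
by rewrite IHn expr0n /= mul0r mulr0 subr0 mulrN -invfM -exprS.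
Qed.

Lemma integral_expR_exprn n :
  (\int[lebesgue_measure]_(t in `[0%R, +oo[) (expR (- (g * t)) * t ^+ n / n`!%:R)%:E
    = ((g ^+ n.+1)^-1)%:E)%E.
Proof.
have dF t := is_derive_gamma_primitive n t.
have cF : continuous (gamma_primitive n).
  by move=> t; apply/differentiable_continuous/derivable1_diffP.
rewrite (@ge0_continuous_FTC2y _ _ (gamma_primitive n) _ 0).
- by rewrite gamma_primitive0 sub0e -EFinN opprK.
- by move=> t t0; rewrite !mulr_ge0 ?expR_ge0 ?exprn_ge0 // invr_ge0.
- apply: continuous_subspaceT => t; apply: cvgM; last exact: cvg_cst.
  apply: cvgM; last exact: exprn_continuous.
  by apply: continuous_comp; [apply: continuousN; apply: cvgM => //; exact: cvg_cst
                             | exact: continuous_expR].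
- exact: cvg_gamma_primitive.
- by move=> t _.
- apply: cvg_at_right_filter; exact: cF.
- by move=> t _; rewrite derive1E; apply: derive_val.
Qed.
Lemma measurable_expR_exprn (D : set R) n :
  @measurable_fun _ _ R R D (fun t => expR (- (g * t)) * t ^+ n / n`!%:R).
Proof.
apply: measurable_funM; last exact: measurable_cst.
apply: measurable_funM; last exact: measurable_funX.
apply: measurableT_comp => //; apply: measurableT_comp => //.
Qed.
End GammaIntegral.

Section KillBound.
Local Open Scope classical_set_scope.
Variables (R : realType) (d : nat) (lam mu : 'I_d -> R) (P : 'M[R]_d).
Hypotheses (lam_ge0 : forall j, 0 <= lam j) (mu_gt0 : forall j, 0 < mu j).
Hypotheses (P_ge0 : forall j k, 0 <= P j k).
Hypothesis P_sub : forall j, \sum_(k < d) P j k <= 1.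

Lemma Lam_ge0 : 0 <= Lam lam mu.
Proof. by apply: sumr_ge0 => j _; rewrite addr_ge0 // ltW. Qed.

Lemma Kone_ge0 x y : 0 <= Kone lam mu P x y.
Proof.
have mu_ge0 j : 0 <= mu j by rewrite ltW.
have p_ge0 j : 0 <= p0 P j by rewrite subr_ge0.
rewrite /Kone addr_ge0 //.
  rewrite mulr_ge0 ?invr_ge0 ?Lam_ge0 //; apply: sumr_ge0 => j _.
  by rewrite !addr_ge0 ?sumr_ge0 // => *; rewrite !mulr_ge0.
rewrite mulr_ge0 // subr_ge0.
have [->|L0] := eqVneq (Lam lam mu) 0; first by rewrite invr0 mulr0.
rewrite ler_pdivrMr ?mul1r; last by rewrite lt_neqAle eq_sym L0 Lam_ge0.
apply: ler_sum => j _; rewrite lerD2l -[leRHS]mulr1 -[leRHS]mul1r -mulrA.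
have out_le1 : p0 P j + \sum_(k < d | k != j) P j k <= 1.
  by rewrite /p0 addrAC lerBlDr lerD2l [leRHS](bigD1 j) //= lerDr.
case: (0 < x j)%N => /=; last by rewrite !mul0r mul1r mulr1.
by rewrite !mul1r ler_wpM2l.
Qed.

Lemma Kkill_ge0 E n x y : 0 <= Kkill lam mu P E n x y.
Proof.
elim: n x => [|n IHn] x /=; first by rewrite ler0n.
by apply: sumr_ge0 => z _; rewrite mulr_ge0 ?Kone_ge0.
Qed.

Lemma KkillD E n m x y z :
  Kkill lam mu P E n x y * Kkill lam mu P E m y z <= Kkill lam mu P E (n + m) x z.
Proof.
elim: n x => [|n IHn] x /=.
  by have [->|_] := eqVneq x y; rewrite ?mul1r // mul0r Kkill_ge0.
rewrite mulr_suml; apply: ler_sum => u _.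
by rewrite -mulrA ler_wpM2l ?Kone_ge0.
Qed.

(** The weight in the integral is at least [expR (th * t)]. Keeping only the [n]-th Poisson term
    leaves a gamma integral, a power of [Lam - th]. *)
Lemma Kkill_bounded E (r th : R) x y : 0 < r -> r <= expR (- th) -> th < Lam lam mu ->
  (\int[lebesgue_measure]_(t in `[0%R, +oo[%classic)
          ((r `^ (- t))%:E * ptkill lam mu P E t x y) < +oo)%E ->
  exists C, forall n, Lam lam mu ^+ n * Kkill lam mu P E n x y <= C * (Lam lam mu - th) ^+ n.
Proof.
set L := Lam lam mu => r0 rth thL.
set f := (X in (\int[_]_(t in _) X t < _)%E) => If.
set K := Kkill lam mu P E.
have term_ge0 n t : 0 <= t -> 0 <= expR (- (L * t)) * (L * t) ^+ n / n`!%:R * K n x y.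
  move=> t0; rewrite !mulr_ge0 ?expR_ge0 ?invr_ge0 ?Kkill_ge0 ?exprn_ge0 //.
  by rewrite mulr_ge0 ?Lam_ge0.
have f_ge0 t : (`[0%R, +oo[%classic : set R) t -> (0 <= f t)%E.
  rewrite /= in_itv /= andbT => t0; rewrite /f mule_ge0 ?lee_fin ?powR_ge0 //.
  by apply: nneseries_ge0 => n _ _; rewrite lee_fin term_ge0.
pose g := L - th; have g_gt0 : 0 < g by rewrite subr_gt0.
have I_ge0 : (0 <= \int[lebesgue_measure]_(t in `[0%R, +oo[) f t)%E.
  exact: integral_ge0.
(* The gamma integral is [(g ^+ n.+1)^-1]; the factor [g] here absorbs the surplus in the
   exponent. *)
exists (fine (\int[lebesgue_measure]_(t in `[0%R, +oo[) f t)%E * g) => n.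
have : ((L ^+ n * K n x y)%:E * (\int[lebesgue_measure]_(t in `[0%R, +oo[)
           (expR (- (g * t)) * t ^+ n / n`!%:R)%:E)
     <= \int[lebesgue_measure]_(t in `[0%R, +oo[) f t)%E.
  have c_ge0 : 0 <= L ^+ n * K n x y by rewrite mulr_ge0 ?exprn_ge0 ?Lam_ge0 ?Kkill_ge0.
  rewrite -ge0_integralZl_EFin //; first last.
  - by apply/measurable_EFinP; exact: measurable_expR_exprn.
  - move=> t; rewrite /= in_itv /= andbT => t0.
    by rewrite lee_fin !mulr_ge0 ?expR_ge0 ?exprn_ge0 ?invr_ge0.
  apply: ge0_le_integral => //.
  - move=> t; rewrite /= in_itv /= andbT => t0.
    apply: mule_ge0; rewrite lee_fin ?c_ge0 //.
    by rewrite !mulr_ge0 ?expR_ge0 ?exprn_ge0 ?invr_ge0.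
  - by apply: measurable_funeM; apply/measurable_EFinP; exact: measurable_expR_exprn.
  - apply: emeasurable_funM.
      apply/measurable_EFinP.
      rewrite (_ : (fun t => r `^ (- t)) = (fun t => expR (- t * ln r))); last first.
        by apply/funext => t; rewrite /powR gt_eqF.
      apply: measurableT_comp => //; apply: measurable_funM => //.
    apply: (@ge0_emeasurable_sum _ _ _ _ _ xpredT) => //.
      by move=> m t; rewrite /= in_itv /= andbT => t0 _; rewrite lee_fin term_ge0.
    move=> m _; apply/measurable_EFinP; apply: measurable_funM => //.
    rewrite (_ : (fun t => _) = (fun t => L ^+ m * (expR (- (L * t)) * t ^+ m / m`!%:R))).
      by apply: measurable_funM => //; exact: measurable_expR_exprn.
    by apply/funext => t; rewrite exprMn; ring.
  - move=> t; rewrite /= in_itv /= andbT => t0.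
    apply: (@le_trans _ _ ((r `^ (- t))%:E *
        (expR (- (L * t)) * (L * t) ^+ n / n`!%:R * K n x y)%:E)%E).
      rewrite -!EFinM lee_fin.
      have -> : L ^+ n * K n x y * (expR (- (g * t)) * t ^+ n / n`!%:R) =
        expR (th * t) * (expR (- (L * t)) * (L * t) ^+ n / n`!%:R * K n x y).
        have -> : - (g * t) = th * t + - (L * t) by rewrite /g; ring.
        by rewrite expRD exprMn; ring.
      rewrite ler_wpM2r ?term_ge0 //.
      rewrite /powR gt_eqF // ler_expR mulNr -mulrN mulrC ler_wpM2l // lerNr.
      by rewrite -ler_expR lnK // posrE.
    rewrite lee_wpmul2l ?lee_fin ?powR_ge0 // /ptkill.
    apply: le_trans (nneseries_lim_ge n.+1 _).
      rewrite big_nat_recr //= leeDr // sume_ge0 // => k _.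
      by rewrite lee_fin term_ge0.
    by move=> k _ _; rewrite lee_fin term_ge0.
rewrite integral_expR_exprn // -EFinM.
rewrite -[X in (_ <= X)%E -> _]fineK ?ge0_fin_numE // lee_fin.
by rewrite ler_pdivrMr ?exprn_gt0 // exprS mulrA.
Qed.
End KillBound.

(** * The network with a saturated server *)

Section Monomial.
Variables (R : realFieldType) (d : nat).

Definition monomial (a : 'I_d -> R) (x : 'rV[int]_d) : R := \prod_j a j ^ x 0 j.

Variable a : 'I_d -> R.
Hypothesis a_gt0 : forall j, 0 < a j.

Lemma monomial_gt0 x : 0 < monomial a x.
Proof. by apply: prodr_gt0 => j _; exact: exprz_gt0. Qed.

Lemma monomial0 : monomial a 0 = 1.
Proof. by rewrite /monomial big1 // => j _; rewrite mxE. Qed.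

Lemma monomialD x y : monomial a (x + y) = monomial a x * monomial a y.
Proof.
rewrite -big_split; apply: eq_bigr => j _; rewrite mxE expfzDr //.
by rewrite gt_eqF.
Qed.

Lemma monomialN x : monomial a (- x) = (monomial a x)^-1.
Proof.
apply: (@mulIf _ (monomial a x)); first by rewrite gt_eqF ?monomial_gt0.
by rewrite -monomialD addNr monomial0 mulVf // gt_eqF ?monomial_gt0.
Qed.

Lemma monomial_eZ j : monomial a (eZ j) = a j.
Proof.
rewrite /monomial (bigD1 j) //= !mxE !eqxx expr1z big1 ?mulr1 // => k kj.
by rewrite !mxE (negbTE kj) andbF.
Qed.

Lemma monomialM b x : monomial a x * monomial b x = monomial (fun j => a j * b j) x.
Proof. by rewrite -big_split; apply: eq_bigr => j _; rewrite expfzMl. Qed.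
End Monomial.

Section FreeNetwork.
Variables (R : realType) (d : nat) (lam mu : 'I_d -> R) (P : 'M[R]_d) (i : 'I_d).
Hypotheses (lam_ge0 : forall j, 0 <= lam j) (mu_gt0 : forall j, 0 < mu j).
Hypotheses (P_ge0 : forall j k, 0 <= P j k).
Hypothesis P_sub : forall j, \sum_(k < d) P j k <= 1.

Local Notation space := 'rV[int]_d.

Definition active (x : space) (j : 'I_d) : bool := (j == i) || (0 < x 0 j).

Definition valid (x : space) : bool := [forall j, (j != i) ==> (0 <= x 0 j)].

(* An arrival at [j], a service at [j] with its destination ([None]: the exterior),
   or an idle service at [j]. *)
Definition event : finType := ('I_d + 'I_d * option 'I_d + 'I_d)%type.

(** Idle services keep the total rate equal to [Lam] everywhere; they stand for the holding
    probability of the uniformized chain. *)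
Definition event_rate (a : event) (x : space) : R :=
  match a with
  | inl (inl j) => lam j
  | inl (inr (j, o)) =>
      (active x j)%:R * (mu j * (if o is Some k then P j k else p0 P j))
  | inr j => (~~ active x j)%:R * mu j
  end.

Definition event_shift (a : event) : space :=
  match a with
  | inl (inl j) => eZ j
  | inl (inr (j, o)) => (if o is Some k then eZ k else 0) - eZ j
  | inr j => 0
  end.

Local Notation T := (jump_op event_rate event_shift).
Local Notation K := (jump_ker event_rate event_shift).

Lemma event_rate_ge0 a x : 0 <= event_rate a x.
Proof.
have mu_ge0 j : 0 <= mu j by rewrite ltW.
have p_ge0 j : 0 <= p0 P j by rewrite subr_ge0.
by case: a => [[j|[j [k|]]]|j] //=; rewrite !mulr_ge0.
Qed.

Lemma big_event (F : event -> R) :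
  \sum_a F a = \sum_j F (inl (inl j))
     + \sum_j (F (inl (inr (j, None))) + \sum_k F (inl (inr (j, Some k))))
     + \sum_j F (inr j).
Proof.
rewrite big_sumType big_sumType /=; congr (_ + _ + _).
rewrite (eq_bigr (fun p => F (inl (inr (p.1, p.2))))); last by case.
rewrite -(pair_bigA _ (fun j o => F (inl (inr (j, o))))) /=.
apply: eq_bigr => j _; rewrite (bigD1 None) //=; congr (_ + _).
rewrite (reindex_omap Some id) /=; last by case.
by apply: eq_bigl => k; rewrite eqxx.
Qed.

Lemma eZE (j k : 'I_d) : eZ j 0 k = (k == j)%:R.
Proof. by rewrite /eZ mxE eqxx. Qed.

Lemma validP (x : space) : reflect (forall j, j != i -> 0 <= x 0 j) (valid x).
Proof. by apply: (iffP forallP) => H j; [move=> ji; have := H j; rewrite ji | apply/implyP/H]. Qed.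

Lemma valid_event (x : space) a : valid x -> event_rate a x != 0 -> valid (x + event_shift a).
Proof.
move=> /validP vx ra; apply/validP => k ki; have := vx k ki.
case: a ra => [[j _|[j o]]|j _] /=; rewrite !mxE ?addr0 //=.
  by case: (k == j) => /=; lia.
rewrite /active; case: (eqVneq k j) => [<-|kj _].
  rewrite (negbTE ki) /=; case: ltP; last by rewrite mul0r eqxx.
  by move=> + _ _; case: o => [l|]; rewrite ?mxE /=; [case: (_ == l)|]; lia.
by case: o => [l|]; rewrite ?mxE /= ?(negbTE kj) ?eqxx /=; [case: (k == l)|]; rewrite /=; lia.
Qed.

(** The condition at [j != i] makes a service at [j] contribute [mu j], exactly as an idle service
    does, so empty queues create no boundary term. Server [i] never idles and gives the last summand
    of the eigenvalue. *)
Lemma iter_monomial_eigen (a : 'I_d -> R) : (forall j, 0 < a j) ->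
  (forall j, j != i -> p0 P j + \sum_k P j k * a k = a j) ->
  forall n x, iter n T (monomial a) x =
    (\sum_j lam j * a j + \sum_(j | j != i) mu j
      + mu i * (p0 P i + \sum_k P i k * a k) / a i) ^+ n * monomial a x.
Proof.
move=> a_gt0 aE n x; apply: (@iter_jump_eigen _ _ _ _ _ _ predT) => // {}x _.
have a_neq0 j : a j != 0 by rewrite gt_eqF.
set M := monomial a x.
have Meq j z : monomial a (x + (z - eZ j)) = M * (monomial a z / a j).
  by rewrite !monomialD // monomialN // monomial_eZ.
have arrivals : \sum_j lam j * monomial a (x + eZ j) = (\sum_j lam j * a j) * M.
  by rewrite mulr_suml; apply: eq_bigr => j _; rewrite monomialD // monomial_eZ // mulrCA mulrC.
have services j : (active x j)%:R * (mu j * p0 P j) * monomial a (x + (0 - eZ j))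
    + \sum_k (active x j)%:R * (mu j * P j k) * monomial a (x + (eZ k - eZ j))
    + (~~ active x j)%:R * mu j * monomial a (x + 0)
  = (if j == i then mu i * (p0 P i + \sum_k P i k * a k) / a i else mu j) * M.
  rewrite addr0 Meq monomial0 (eq_bigr (fun k => (active x j)%:R * (mu j * M / a j) * (P j k * a k))); last first.
    by move=> k _; rewrite Meq monomial_eZ //; field.
  rewrite -mulr_sumr.
  have -> : (active x j)%:R * (mu j * p0 P j) * (M * (1 / a j))
    = (active x j)%:R * (mu j * M / a j) * p0 P j by field.
  rewrite -mulrDr /active; have [->|ji] := eqVneq j i.
    by rewrite /= mul1r mul0r mul0r addr0; field.
  rewrite aE //=; case: (0 < x 0 j); rewrite /= ?mul1r ?mul0r ?addr0 ?add0r //.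
  by field.
rewrite /jump_op big_event /= arrivals -addrA -big_split /= (eq_bigr _ (fun j _ => services j)).
rewrite [X in _ + X](bigD1 i) //= eqxx [X in _ + (_ + X)](eq_bigr (fun j => mu j * M)); last by move=> j /negbTE->.
by rewrite -mulr_suml; ring.
Qed.

Section LeftEigen.
Variable u : 'I_d -> R.
Hypothesis u_gt0 : forall j, 0 < u j.
Hypothesis uE : forall k, k != i -> lam k + \sum_j u j * P j k = u k.

Let sigma j := u j / mu j.

Let sigma_gt0 j : 0 < sigma j. Proof. by rewrite divr_gt0. Qed.

Let lm (y : space) : R := (valid y)%:R * monomial sigma y.

(** A product-form measure as in Jackson's theorem: [uE] is the traffic equation away from [i], and
    balance at each node yields the supersolution needed by [jump_ker_le]. *)
Lemma free_ker_le n y :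
  K n 0 y <= (\sum_(j | j != i) mu j + \sum_j u j * p0 P j
     + mu i * (lam i + \sum_j u j * P j i) / u i) ^+ n
    * ((valid y)%:R * monomial (fun j => u j / mu j) y).
Proof.
have mu_ge0 j : 0 <= mu j by rewrite ltW.
have u_ge0 j : 0 <= u j by rewrite ltW.
have p_ge0 j : 0 <= p0 P j by rewrite subr_ge0.
have M_ge0 z : 0 <= monomial sigma z by rewrite ltW // monomial_gt0.
set e := (X in X ^+ n).
have e_ge0 : 0 <= e.
  rewrite /e !addr_ge0 ?sumr_ge0 // => [j _|]; first by rewrite mulr_ge0.
  by rewrite divr_ge0 // mulr_ge0 // addr_ge0 // sumr_ge0 // => j _; rewrite mulr_ge0.
rewrite -/sigma -/(lm y).
apply: jump_ker_le => //; first exact: event_rate_ge0.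
- rewrite /lm monomial0 mulr1 (_ : valid 0) //; apply/validP => j _.
  by rewrite mxE.
- by move=> z; rewrite /lm mulr_ge0.
move=> {n}z; have [vz|nvz] := boolP (valid z); last first.
  rewrite big1 /lm ?(negbTE nvz) ?mul0r ?mulr0 // => a _.
  have [->|ra] := eqVneq (event_rate a (z - event_shift a)) 0; first by rewrite mul0r.
  have [vza|_] := boolP (valid (z - event_shift a)); last by rewrite mul0r mulr0.
  by have := valid_event vza ra; rewrite subrK (negbTE nvz).
rewrite {2}/lm vz mul1r; set M := monomial sigma z.
have Meq w : monomial sigma (z - w) = M / monomial sigma w.
  by rewrite monomialD // monomialN.
have s_neq0 j : sigma j != 0 by rewrite gt_eqF.
(* An arrival at [k] from a valid point leaves [k] active, so inflow to [k] is counted only when [k]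
   is active at [z]. *)
have act_valid (a : event) k : event_shift a 0 k = 1 -> valid (z - event_shift a) -> active z k.
  rewrite /active; have [//|ki] := eqVneq k i => ak /validP/(_ k ki).
  by rewrite !mxE ak /=; lia.
have act (a : event) k c : 0 <= c -> event_shift a 0 k = 1 ->
    c * lm (z - event_shift a) <= (active z k)%:R * (c * (M / monomial sigma (event_shift a))).
  move=> c0 ak; rewrite /lm.
  have [va|_] := boolP (valid (z - event_shift a)); last first.
    by rewrite mul0r mulr0 !mulr_ge0 ?invr_ge0 //; exact: M_ge0.
  by rewrite (act_valid _ _ ak va) !mul1r Meq.
have arrivals j : lam j * lm (z - eZ j) <= (active z j)%:R * (lam j / sigma j) * M.
  apply: le_trans (act (inl (inl j)) j _ (lam_ge0 j) _) _; first by rewrite /= eZE eqxx.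
  by rewrite /= monomial_eZ // le_eqVlt; apply/orP; left; apply/eqP; ring.
have rate_le x j c : 0 <= c -> (active x j)%:R * c <= c.
  by move=> c0; case: (active x j); rewrite ?mul1r ?mul0r.
have lm_le x : lm x <= monomial sigma x.
  by rewrite /lm; case: (valid x); rewrite ?mul1r // mul0r.
have exits j : (active (z - (0 - eZ j)) j)%:R * (mu j * p0 P j) * lm (z - (0 - eZ j))
    <= u j * p0 P j * M.
  apply: (@le_trans _ _ (mu j * p0 P j * monomial sigma (z - (0 - eZ j)))).
    by rewrite ler_pM // ?mulr_ge0 ?rate_le ?mulr_ge0 // /lm mulr_ge0.
  rewrite Meq sub0r monomialN // invrK monomial_eZ // le_eqVlt; apply/orP; left; apply/eqP.
  by rewrite /sigma; field; rewrite gt_eqF.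
have transfers j k : (active (z - (eZ k - eZ j)) j)%:R * (mu j * P j k)
    * lm (z - (eZ k - eZ j)) <= (active z k)%:R * (u j * P j k / sigma k) * M.
  have -> : u j * P j k / sigma k = mu j * P j k * (sigma j / sigma k).
    by rewrite /sigma; field; rewrite ?gt_eqF.
  have [->|jk] := eqVneq j k.
    by rewrite subrr subr0 /lm vz divff // mulr1 /= mul1r.
  apply: (@le_trans _ _ (mu j * P j k * lm (z - (eZ k - eZ j)))).
    by rewrite ler_wpM2r ?rate_le ?mulr_ge0 // /lm mulr_ge0.
  apply: le_trans (act (inl (inr (j, Some k))) k _ _ _) _.
  - by rewrite mulr_ge0.
  - by rewrite /= !mxE !eqxx eq_sym (negbTE jk) subr0.
  rewrite /= monomialD // monomialN // !monomial_eZ // le_eqVlt; apply/orP; left; apply/eqP.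
  by field; rewrite ?s_neq0.
rewrite big_event /=; apply: (@le_trans _ _
  (\sum_j (active z j)%:R * (lam j / sigma j) * M
   + \sum_j (u j * p0 P j * M + \sum_k (active z k)%:R * (u j * P j k / sigma k) * M)
   + \sum_j (~~ active z j)%:R * mu j * M)).
  apply: lerD; last first.
    by apply: ler_sum => j _; rewrite subr0 /lm vz mul1r.
  apply: lerD; apply: ler_sum => j _; first exact: arrivals.
  by apply: lerD; [exact: exits | apply: ler_sum => k _; exact: transfers].
(* Inflow regrouped by destination: at an active [k != i] the traffic equation makes it [mu k],
   which is also the idle rate of an inactive [k]. *)
have cell k : (active z k)%:R * (lam k / sigma k) * M
    + \sum_j (active z k)%:R * (u j * P j k / sigma k) * M + (~~ active z k)%:R * mu k * M
    = (if k == i then mu i * (lam i + \sum_j u j * P j i) / u i else mu k) * M.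
  rewrite -mulr_suml -mulr_sumr -mulr_suml -!mulrDl; congr (_ * M).
  rewrite -mulrDr -mulrDl; have [->|ki] := eqVneq k i.
    by rewrite /active eqxx /= mul1r mul0r addr0 /sigma; field; rewrite !gt_eqF.
  rewrite uE // /sigma; case: (active z k); rewrite /= ?mul1r ?mul0r ?addr0 ?add0r //.
  by field; rewrite !gt_eqF.
have -> : e * M = \sum_j u j * p0 P j * M
    + \sum_k (if k == i then mu i * (lam i + \sum_j u j * P j i) / u i else mu k) * M.
  rewrite [X in _ + X](bigD1 i) //= eqxx [X in _ + (_ + X)](eq_bigr (fun j => mu j * M)).
    by rewrite -!mulr_suml /e; ring.
  by move=> j /negbTE->.
rewrite -(eq_bigr _ (fun k _ => cell k)) !big_split /= [X in _ + (_ + X) + _]exchange_big /=.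
by rewrite le_eqVlt; apply/orP; left; apply/eqP; ring.
Qed.
End LeftEigen.
End FreeNetwork.

(** By Bernoulli's inequality. It removes constants that do not grow with the exponent. *)
Lemma expr_bounded_le1 (R : realType) (x C : R) : (forall m, x ^+ m <= C) -> x <= 1.
Proof.
move=> xC; rewrite leNgt; apply/negP => x1.
have bern m : 1 + m%:R * (x - 1) <= x ^+ m.
  elim: m => [|m IHm]; first by rewrite mul0r addr0.
  rewrite exprS; apply: le_trans (_ : x * (1 + m%:R * (x - 1)) <= _); last first.
    by rewrite ler_wpM2l // ltW // (lt_trans ltr01).
  rewrite -natr1; have : 0 <= m%:R * (x - 1) * (x - 1).
    by rewrite !mulr_ge0 // subr_ge0 ltW.
  by nra.
have := archi_boundP (_ : 0 <= `|C| / (x - 1)); set m := Num.bound _.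
rewrite divr_ge0 // ?subr_ge0 ?ltW // => /(_ isT); rewrite ltr_pdivrMr ?subr_gt0 //.
by have := bern m; have := xC m; have := ler_norm C; lra.
Qed.

(** * Comparison of the free network with the killed network *)

Section Embedding.
Variables (R : realType) (d : nat) (lam mu : 'I_d -> R) (P : 'M[R]_d) (i : 'I_d).
Hypotheses (lam_ge0 : forall j, 0 <= lam j) (mu_gt0 : forall j, 0 < mu j).
Hypotheses (P_ge0 : forall j k, 0 <= P j k) (P_diag : forall j, P j j = 0).
Hypothesis P_sub : forall j, \sum_(k < d) P j k <= 1.

Local Notation space := 'rV[int]_d.
Local Notation K := (jump_ker (event_rate lam mu P i) (@event_shift d)).

Lemma event_shiftE (a : event d) k : event_shift a 0 k =
  match a with
  | inl (inl j) => (k == j)%:R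
  | inl (inr (j, o)) => (if o is Some l then (k == l)%:R else 0) - (k == j)%:R
  | inr _ => 0
  end.
Proof. by case: a => [[j|[j [l|]]]|j] /=; rewrite ?mxE ?eqxx. Qed.

Lemma upE (x : state d) j k : Defs.up x j k = (x k + (k == j))%N.
Proof. by rewrite ffunE. Qed.

Lemma downE (x : state d) j k : Defs.down x j k = (x k - (k == j))%N.
Proof. by rewrite ffunE. Qed.

Lemma Lam_gt0 : 0 < Lam lam mu.
Proof.
rewrite /Lam (bigD1 i) //= ltr_pwDl ?sumr_ge0 ?ltr_wpDl // => j _.
by rewrite addr_ge0 // ltW.
Qed.

Definition state_rate (a : event d) (x : state d) : R :=
  match a with
  | inl (inl j) => lam j
  | inl (inr (j, o)) => (0 < x j)%N%:R * (mu j * (if o is Some k then P j k else p0 P j))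
  | inr j => (~~ (0 < x j)%N)%:R * mu j
  end.

Definition state_jump (a : event d) (x : state d) : state d :=
  match a with
  | inl (inl j) => Defs.up x j
  | inl (inr (j, o)) => if o is Some k then Defs.up (Defs.down x j) k else Defs.down x j
  | inr j => x
  end.

Lemma state_jump_succ a x : state_jump a x \in Defs.succ x.
Proof.
rewrite mem_undup inE !mem_cat; case: a => [[j|[j [k|]]]|j] /=; last by rewrite eqxx.
- by rewrite map_f ?mem_enum // orbT.
- by rewrite (allpairs_f (fun a b => Defs.up (Defs.down x a) b)) ?mem_enum // !orbT.
- by rewrite (map_f (Defs.down x)) ?mem_enum // !orbT.
Qed.

(** Idle services account for the diagonal term of [Kone]. *)
Lemma KoneE x z :
  Lam lam mu * Kone lam mu P x z = \sum_a state_rate a x * (z == state_jump a x)%:R.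
Proof.
rewrite /Kone mulrDr mulrCA mulfV ?gt_eqF ?Lam_gt0 // mulr1.
rewrite mulrCA mulrBr mulr1 mulrCA mulfV ?gt_eqF ?Lam_gt0 // mulr1.
have out j : p0 P j + \sum_(k < d | k != j) P j k = 1.
  by rewrite /p0 [X in 1 - X](bigD1 j) //= P_diag add0r subrK.
rewrite big_event /=; congr (_ + _).
  rewrite /jrate -big_split /=; apply: eq_bigr => j _; rewrite -addrA.
  congr (_ + (_ + _)); first by rewrite mulrA.
  rewrite [RHS](bigD1 j) //= P_diag mulr0 mulr0 mul0r add0r.
  by apply: eq_bigr => k _; rewrite mulrA.
rewrite /Lam /out_rate -sumrB mulr_sumr; apply: eq_bigr => j _.
rewrite out mulr1 mulrC; congr (_ * _).
by case: (0 < x j)%N; rewrite /= ?mul0r ?mul1r; ring.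
Qed.

Lemma Kkill_step E n x y : Lam lam mu * Kkill lam mu P E n.+1 x y =
  \sum_a state_rate a x * ((state_jump a x \notin E)%:R
                            * Kkill lam mu P E n (state_jump a x) y).
Proof.
rewrite /= big_mkcond /= mulr_sumr.
pose g z := (z \notin E)%:R * Kkill lam mu P E n z y.
transitivity (\sum_(z <- Defs.succ x) \sum_a state_rate a x * ((z == state_jump a x)%:R * g z)).
  apply: eq_bigr => z _; rewrite /g; case: (z \notin E); last first.
    by rewrite mulr0 big1 // => a _; rewrite mul0r !mulr0.
  rewrite mulrA KoneE mulr_suml; apply: eq_bigr => a _.
  by rewrite mul1r mulrA.
rewrite exchange_big /=; apply: eq_bigr => a _; rewrite -mulr_sumr; congr (_ * _).
rewrite (bigD1_seq (state_jump a x)) ?state_jump_succ ?undup_uniq //= eqxx mul1r.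
by rewrite big1 ?addr0 // => z /negbTE->; rewrite mul0r.
Qed.

(* Coordinate [i], which ranges over all of [int], is shifted by [M]. *)
Definition embed (M : nat) (x : space) : state d :=
  [ffun k => `|(x 0 k + (if k == i then M%:Z else 0))%R|%N].

(** [E] has height at most [b] in coordinate [i], and a jump lowers that coordinate by at most one.
    Within [n] steps from above [n + b] the walk neither meets [E] nor empties queue [i], so both
    processes make the same jumps. *)
Lemma free_ker_le_Kkill E b M n (x : space) :
  {in E, forall e : state d, (e i <= b)%N} -> valid i x -> (n + b)%:Z < x 0 i + M%:Z ->
  K n x 0 <= Lam lam mu ^+ n * Kkill lam mu P E n (embed M x) (embed M 0).
Proof.
move=> Eb; elim: n x => [|n IHn] x vx xM.
  rewrite mul1r /jump_ker /=; have [->|_] := eqVneq x 0; first by rewrite eqxx.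
  by rewrite ler0n.
have K_ge0 z : 0 <= Kkill lam mu P E n z (embed M 0) by exact: Kkill_ge0.
rewrite exprSr -mulrA Kkill_step jump_kerS mulr_sumr; apply: ler_sum => a _.
have activeE j : active i x j = (0 < embed M x j)%N.
  rewrite /active ffunE; have [->|ji] := eqVneq j i; first by rewrite /=; lia.
  by have := validP _ _ vx j ji; rewrite /= addr0; lia.
have rateE : event_rate lam mu P i a x = state_rate a (embed M x).
  by case: a => [[j|[j o]]|j] //=; rewrite activeE.
have rate_ge0 : 0 <= state_rate a (embed M x) by rewrite -rateE event_rate_ge0.
rewrite rateE [X in _ <= X]mulrCA; have [->|ra] := eqVneq (state_rate a (embed M x)) 0.
  by rewrite !mul0r.
have va : valid i (x + event_shift a) by apply: (valid_event (lam := lam) (mu := mu) (P := P) vx); rewrite rateE.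
have ai : x 0 i - 1 <= (x + event_shift a) 0 i.
  rewrite mxE event_shiftE; case: (a) => [[j|[j [k|]]]|j] /=.
  - by case: (i == j) => /=; lia.
  - by case: (i == k); case: (i == j) => /=; lia.
  - by case: (i == j) => /=; lia.
  - by lia.
rewrite ler_wpM2l //.
have jumpE : state_jump a (embed M x) = embed M (x + event_shift a).
  have X_ge0 k : 0 <= x 0 k + (if k == i then M%:Z else 0).
    by have [->|ki] := eqVneq k i; [lia | rewrite addr0; exact: (validP _ _ vx)].
  have act_gt0 j : (0 < embed M x j)%N -> 0 < x 0 j + (if j == i then M%:Z else 0).
    by have := X_ge0 j; rewrite ffunE; set X := (x 0 j + _); lia.
  apply/ffunP => k; rewrite [RHS]ffunE mxE event_shiftE addrAC.
  have kE : embed M x k = `|(x 0 k + (if k == i then M%:Z else 0))%R|%N by rewrite ffunE.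
  move: (X_ge0 k) (act_gt0 k) kE; set X := (x 0 k + _) => Xk ak kE.
  case: (a) ra => [[j|[j o]]|j] /= ra; last by rewrite kE addr0.
    by rewrite upE kE; case: (k == j) => /=; lia.
  have {}ra : k = j -> 0 < X.
    by move=> kj; apply: ak; rewrite kj; case: (0 < embed M x j)%N ra => //; rewrite mul0r eqxx.
  case: o {ak} => [l|]; rewrite ?upE downE kE; have [/ra X0|_] := eqVneq k j => /=.
  - by case: (k == l) => /=; lia.
  - by move: Xk; clearbody X; case: (k == l) => /=; lia.
  - by lia.
  - by move: Xk; clearbody X; lia.
have bound : (n + b)%:Z < (x + event_shift a) 0 i + M%:Z.
  by move: ai xM; move: (x 0 i) ((x + _) 0 i) => X Y; lia.
rewrite jumpE; have -> : embed M (x + event_shift a) \notin E.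
  by apply/negP => /Eb; rewrite ffunE eqxx; move: bound; move: ((x + _) 0 i) => Y; lia.
by rewrite mul1r IHn.
Qed.

(** The starting height [M], hence the constant [C], depends on [n]; supermultiplicativity along the
    multiples of [n] removes that constant. *)
Lemma free_ker_return (r th : R) : 0 < r -> r <= expR (- th) -> th < Lam lam mu ->
  ess_set lam mu P r -> forall n, K n 0 0 <= (Lam lam mu - th) ^+ n.
Proof.
move=> r0 rth thL [_ [E EP]] n.
pose b := (\sum_(e <- E) e i)%N.
have Eb : {in E, forall e : state d, (e i <= b)%N}.
  by move=> e eE; rewrite /b (big_rem e) //= leq_addr.
pose M := (n + b).+1; pose s := embed M 0.
have sE : s \notin E by apply/negP => /Eb; rewrite ffunE eqxx mxE /=; lia.
have [C CP] := Kkill_bounded lam_ge0 mu_gt0 P_ge0 P_sub r0 rth thL (EP s s sE sE).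
have g_gt0 : 0 < Lam lam mu - th by rewrite subr_gt0.
have := @free_ker_le_Kkill E b M n 0 Eb; rewrite -/s => /(_ _ _)/le_trans; apply.
- by apply/validP => j _; rewrite mxE.
- by rewrite mxE /M; lia.
set a := _ * _.
rewrite -[X in _ <= X]mul1r -ler_pdivrMr ?exprn_gt0 //.
apply: (@expr_bounded_le1 _ _ C) => m.
rewrite expr_div_n -exprM ler_pdivrMr ?exprn_gt0 //; apply: le_trans (CP (n * m)%N).
rewrite /a exprMn -exprM ler_wpM2l ?exprn_ge0 ?Lam_ge0 //.
elim: m => [|m IHm]; first by rewrite muln0 /= eqxx.
rewrite mulnS exprS; apply: (le_trans _ (KkillD lam_ge0 mu_gt0 P_ge0 P_sub E n (n * m)%N s s s)).
by rewrite ler_wpM2l ?Kkill_ge0.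
Qed.
End Embedding.

(** * Communication cost *)

Section Communication.
Variables (R : realType) (d : nat) (lam mu : 'I_d -> R) (P : 'M[R]_d) (i : 'I_d).
Hypotheses (lam_ge0 : forall j, 0 <= lam j) (mu_gt0 : forall j, 0 < mu j).
Hypotheses (P_ge0 : forall j k, 0 <= P j k).
Hypothesis P_sub : forall j, \sum_(k < d) P j k <= 1.
Hypothesis irr : irreducible_q lam mu P.

Local Notation space := 'rV[int]_d.
Local Notation rate := (event_rate lam mu P i).
Local Notation K := (jump_ker rate (@event_shift d)).

Let rate_ge0 := event_rate_ge0 i lam_ge0 mu_gt0 P_ge0 P_sub.

Lemma active_valid (x : space) j : valid i x -> j != i -> active i x j = (x 0 j != 0).
Proof.
by move=> /validP vx ji; rewrite /active (negbTE ji) /= lt_neqAle eq_sym vx ?andbT.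
Qed.

(** Uniformity of [m] and [c] in [x] is what makes the cost of a return exponential in the norm. *)
Definition drains (j : 'I_d) : Prop := exists m c, 0 < c /\
  forall x : space, valid i x -> active i x j -> c <= K m x (x - eZ j).

(** A node that can send customers to the exterior or to a draining node drains as well, so the
    other nodes would contradict [no_absorbing_set]. *)
Lemma all_drain j : drains j.
Proof.
apply: contrapT => nj.
have [|k] := @no_absorbing_set _ _ _ _ _ lam_ge0 mu_gt0 P_ge0 P_sub irr
  [set k | ~~ `[< drains k >]] j; first by rewrite inE; apply/asboolPn.
rewrite inE => /asboolPn nk [pk|[l]].
  apply: nk; exists 1%N, (mu k * p0 P k); split; first exact: mulr_gt0.
  move=> x vx xk; have := jump_ker1 (event_shift (d := d)) rate_ge0 (inl (inr (k, None))) x.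
  by rewrite /= xk mul1r add0r.
rewrite inE negbK => /asboolP[m [c [c0 cK]]] Pkl.
apply: nk; exists m.+1, (mu k * P k l * c); split; first by rewrite !mulr_gt0.
move=> x vx xk; pose a : event d := inl (inr (k, Some l)).
have rateE : rate a x = mu k * P k l by rewrite /= xk mul1r.
have va : valid i (x + event_shift a).
  by apply: (valid_event (lam := lam) (mu := mu) (P := P) vx); rewrite rateE gt_eqF ?mulr_gt0.
apply: le_trans (jump_kerD _ rate_ge0 1 m x (x + event_shift a) _).
rewrite -rateE ler_pM //; first exact: ltW; first exact: jump_ker1.
have -> : x - eZ k = x + event_shift a - eZ l by rewrite /= addrA addrAC addrK.
apply: cK => //; have [->|li] := eqVneq l i; first by rewrite /active eqxx.
rewrite /active; move: xk; rewrite /active mxE event_shiftE /=.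
have := validP _ _ vx l li; have [lk|lk] := eqVneq l k; rewrite ?eqxx (negbTE li) /=.
  by rewrite -lk (negbTE li) /=; move: (x 0 l) => X; lia.
by move=> + _; move: (x 0 l) => X; lia.
Qed.

Definition fills (j : 'I_d) : Prop := exists m c, 0 < c /\
  forall x : space, valid i x -> c <= K m x (x + eZ j).

(** Dual argument with [no_isolated_set]: a customer created at [l] can be routed on to [k]. *)
Lemma all_fill j : fills j.
Proof.
apply: contrapT => nj.
have [|k] := @no_isolated_set _ _ _ _ _ lam_ge0 mu_gt0 P_ge0 P_sub irr
  [set k | ~~ `[< fills k >]] j; first by rewrite inE; apply/asboolPn.
rewrite inE => /asboolPn nk [lk|[l]].
  apply: nk; exists 1%N, (lam k); split => // x vx.
  exact: (jump_ker1 (event_shift (d := d)) rate_ge0 (inl (inl k)) x).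
rewrite inE negbK => /asboolP[m [c [c0 cK]]] Plk.
apply: nk; exists (m + 1)%N, (c * (mu l * P l k)); split; first by rewrite !mulr_gt0.
move=> x vx; pose a : event d := inl (inr (l, Some k)).
have al : active i (x + eZ l) l.
  rewrite /active; have [//|li] := eqVneq l i; rewrite mxE eZE eqxx /=.
  by have := validP _ _ vx l li; move: (x 0 l) => X; lia.
have rateE : rate a (x + eZ l) = mu l * P l k by rewrite /= al mul1r.
apply: le_trans (jump_kerD _ rate_ge0 m 1 x (x + eZ l) _).
rewrite -rateE ler_pM //; [exact: ltW | exact: cK |].
have -> : x + eZ k = x + eZ l + event_shift a by rewrite /= addrA addrAC addrK.
exact: jump_ker1.
Qed.

Definition norm1 (x : space) : nat := \sum_j `|x 0%R j|%N.

Lemma norm1_eZ (x : space) j : 0 < x 0 j -> norm1 x = (norm1 (x - eZ j)).+1.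
Proof.
move=> xj; rewrite /norm1 (bigD1 j) //= [in RHS](bigD1 j) //= -addSn; congr (_ + _)%N.
  by rewrite !mxE !eqxx /=; move: (x 0 j) xj => X; lia.
by apply: eq_bigr => k kj; rewrite !mxE (negbTE kj) andbF subr0.
Qed.

(** Induction on the norm: each unit is removed by draining, or by filling when coordinate [i] is
    negative, at a uniform cost. *)
Lemma return_cost (g : R) : 0 < g -> exists c, [/\ 0 < c, c <= 1 &
  forall y : space, valid i y -> exists m, c ^+ norm1 y * g ^+ m <= K m y 0].
Proof.
move=> g0.
have [f fP] := choice all_drain; have {fP}[cd cdP] := choice fP.
have [mf [cf [cf0 cfP]]] := all_fill i.
(* Each cost is divided by [g] to the number of steps spent, so that paths of any length [m] are
   measured against [g ^+ m]. *)
pose c := Num.min (cf / g ^+ mf) (\big[Num.min/1]_j (cd j / g ^+ f j)).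
have gm m : 0 < g ^+ m by exact: exprn_gt0.
have c0 : 0 < c.
  rewrite lt_min divr_gt0 //=; apply: lt_bigmin => // j _.
  by rewrite divr_gt0 //; case: (cdP j).
have c1 : c <= 1 by rewrite ge_min bigmin_le_id orbT.
exists c; split => // y.
have [N] := ubnP (norm1 y); elim: N y => // N IHN y; rewrite ltnS => yN vy.
have step z m : valid i z -> norm1 y = (norm1 z).+1 -> c * g ^+ m <= K m y z ->
    exists m, c ^+ norm1 y * g ^+ m <= K m y 0.
  move=> vz yz cK; have [|k' kP] := IHN z _ vz; first by rewrite -yz.
  exists (m + k')%N; apply: le_trans (jump_kerD _ rate_ge0 m k' y z 0).
  rewrite yz exprS exprD mulrACA ler_pM // ?mulr_ge0 ?exprn_ge0 //; exact: ltW.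
have drain j : active i y j -> 0 < y 0 j -> exists m, c ^+ norm1 y * g ^+ m <= K m y 0.
  move=> ay yj; have [cj0 cjP] := cdP j.
  apply: (step (y - eZ j) (f j)); last 2 first.
  - exact: norm1_eZ.
  - apply: le_trans (cjP y vy ay); rewrite -ler_pdivlMr // ge_min; apply/orP; right.
    exact: bigmin_le_cond.
  apply/validP => k ki; have := validP _ _ vy k ki; rewrite !mxE eqxx /=.
  by have [->|_] := eqVneq k j; [move: (y 0 j) yj => Y | move: (y 0 k) => Y]; lia.
case: (ltgtP (y 0 i) 0) => yi.
- apply: (step (y + eZ i) mf).
  + apply/validP => k ki; have := validP _ _ vy k ki.
    by rewrite mxE eZE (negbTE ki) addr0.
  + rewrite /norm1 (bigD1 i) //= [in RHS](bigD1 i) //= -addSn; congr (_ + _)%N.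
      by rewrite !mxE !eqxx /=; move: (y 0 i) yi => Y; lia.
    by apply: eq_bigr => k ki; rewrite !mxE (negbTE ki) andbF addr0.
  + by apply: le_trans (cfP y vy); rewrite -ler_pdivlMr // ge_min lexx.
- by apply: (drain i) => //; rewrite /active eqxx.
have [->|y0] := eqVneq y 0.
  exists 0%N; rewrite /norm1 big1 ?mulr1; last by move=> j _; rewrite mxE.
  by rewrite /jump_ker /= eqxx.
have [j yj] : exists j, y 0 j != 0.
  apply/existsP; apply: contraNT y0; rewrite negb_exists => /forallP H.
  by apply/eqP/rowP => j; rewrite mxE; apply/eqP; rewrite -[_ == _]negbK H.
have ji : j != i by apply: contraNneq yj => ->; rewrite yi.
apply: (drain j); first by rewrite active_valid.
by rewrite lt_neqAle eq_sym yj (validP _ _ vy).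
Qed.

(** A passage to [y] followed by the path of [return_cost] is a return to the origin, whose weight
    is bounded by assumption. *)
Lemma free_ker_le_return (g : R) : 0 < g -> (forall n, K n 0 0 <= g ^+ n) ->
  exists c, [/\ 0 < c, c <= 1 &
    forall n y, valid i y -> K n 0 y <= g ^+ n * c^-1 ^+ norm1 y].
Proof.
move=> g0 Kg; have [c [c0 c1 cP]] := return_cost g0; exists c; split => // n y vy.
have [m mP] := cP y vy.
rewrite exprVn ler_pdivlMr ?exprn_gt0 // -(ler_pM2r (exprn_gt0 m g0)) -exprD.
apply: le_trans (Kg (n + m)%N); apply: le_trans (jump_kerD _ rate_ge0 n m 0 y 0).
by rewrite -mulrA ler_wpM2l // jump_ker_ge0.
Qed.
End Communication.

(** * Boxes, polynomial factors and bounds on monomials *)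

Lemma polynomial_geometric_lt1 (R : realType) (q : R) (L d : nat) : 0 < q -> q < 1 ->
  exists k, (L * k).+1%:R ^+ d * q ^+ k < 1.
Proof.
move=> q0 q1; have g0 : 0 < - ln q by rewrite oppr_gt0 ln_lt0 // q0.
have c0 : 0 < (L.+1%:R ^+ d)^-1 :> R by rewrite invr_gt0 exprn_gt0.
have /cvgrPdist_lt/(_ _ c0)[M [_ MP]] := cvg_exprn_expRN g0 d.
pose k := (Num.bound `|M|).+1; exists k.
have Mk : M < k%:R.
  apply: le_lt_trans (ler_norm M) _.
  by apply: lt_trans (archi_boundP (normr_ge0 M)) _; rewrite ltr_nat.
have := MP _ Mk; rewrite /= sub0r normrN ger0_norm; last first.
  by rewrite mulr_ge0 ?exprn_ge0 ?expR_ge0.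
rewrite mulNr opprK expRM_natr lnK ?posrE // => H.
have [k1 k0] : (L * k).+1%:R <= L.+1%:R * k%:R :> R /\ 0 < k%:R :> R.
  by rewrite -natrM ler_nat ltr0n /k; split; lia.
apply: (@le_lt_trans _ _ ((L.+1%:R * k%:R) ^+ d * q ^+ k)).
  by rewrite ler_wpM2r ?exprn_ge0 ?(ltW q0) // lerXn2r // nnegrE // mulr_ge0 // ltW.
by rewrite exprMn -mulrA -ltr_pdivlMl ?mulr1 // exprn_gt0.
Qed.

Section Box.
Variable d : nat.
Local Notation space := 'rV[int]_d.

Definition box (N : nat) : seq space :=
  [seq (\row_j ((f j)%:Z - N%:Z)) | f : {ffun 'I_d -> 'I_(N.*2.+1)}].

Lemma box_uniq N : uniq (box N).
Proof.
rewrite map_inj_uniq ?enum_uniq // => f g /rowP fg; apply/ffunP => j.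
by have := fg j; rewrite !mxE => /addIr[fgj]; apply: val_inj.
Qed.

Lemma size_box N : size (box N) = (N.*2.+1 ^ d)%N.
Proof. by rewrite size_map -cardE card_ffun !card_ord. Qed.

Lemma mem_box N (y : space) : (forall j, (`|y 0%R j| <= N)%N) -> y \in box N.
Proof.
move=> yN; apply/mapP.
exists [ffun j => inord `|(y 0 j + N%:Z)%R|%N]; first by rewrite mem_enum.
apply/rowP => j; rewrite mxE ffunE inordK.
  by have := yN j; move: (y 0 j) => Y; lia.
by rewrite ltnS; have := yN j; move: (y 0 j) => Y; lia.
Qed.


Lemma iter_jump_box (R : realType) (w : event d -> space -> R) (f : space -> R) N :
  iter N (jump_op w (@event_shift d)) f 0
  = \sum_(y <- box N) f y * jump_ker w (@event_shift d) N 0 y.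
Proof.
(* [V m] holds the points that [m] further jumps keep in the box, since an event changes each
   coordinate by at most one. *)
pose V m : pred space := fun x => [forall j, (`|x 0%R j| + m <= N)%N].
apply: (@iter_jump_expand _ _ _ _ _ _ V) => //; first exact: box_uniq.
- by apply/forallP => j; rewrite mxE.
- by move=> y /forallP yV; apply: mem_box => j; have := yV j; rewrite addn0.
move=> m y a /forallP yV; apply/forallP => j; have := yV j; rewrite mxE event_shiftE.
move: (y 0 j) => Y; case: a => [[l|[l [k|]]]|l] /=; [| | | lia].
- by case: (j == l) => /=; lia.
- by case: (j == l); case: (j == k) => /=; lia.
- by case: (j == l) => /=; lia.
Qed.
End Box.

Lemma exprz_le_expr (R : realFieldType) (x : R) (k : nat) (z : int) :
  0 < x -> x <= 1 -> k%:Z <= z -> x ^ z <= x ^+ k.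
Proof.
move=> x0 x1; case: z => z // kz; rewrite -exprnP.
rewrite -(subnK (_ : k <= z)%N); last by lia.
by rewrite exprD ler_piMl ?exprn_ge0 ?exprn_ile1 // ltW.
Qed.

Lemma monomial_le (R : realFieldType) d (f : 'I_d -> R) (y : 'rV[int]_d) j (b : R) :
  (forall k, 0 < f k) -> (forall k, k != j -> f k ^ y 0 k <= 1) -> f j ^ y 0 j <= b ->
  monomial f y <= b.
Proof.
move=> f0 f1 fj; rewrite /monomial (bigD1 j) //= -[b]mulr1.
have ge0 k : 0 <= f k ^ y 0 k by rewrite ltW // exprz_gt0.
rewrite ler_pM ?prodr_ge0 //; apply: prodr_ile1 => k kj.
by rewrite ge0 f1.
Qed.

Lemma monomial_le_norm1 (R : realFieldType) d (f : 'I_d -> R) (y : 'rV[int]_d) (A : R) :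
  (forall k, 1 <= f k <= A) -> monomial f y <= A ^+ norm1 y.
Proof.
move=> fA; rewrite /norm1 expr_sum; apply: ler_prod => j _.
have /andP[f1 fjA] := fA j; have f0 : 0 < f j by apply: lt_le_trans f1.
rewrite ltW ?exprz_gt0 //=; case: (y 0 j) => m.
  by rewrite -exprnP absz_nat lerXn2r // nnegrE ltW // (lt_le_trans f0).
apply: (@le_trans _ _ 1); last by rewrite exprn_ege1 // (le_trans f1).
by rewrite NegzE -exprnN invf_le1 ?exprn_gt0 // exprn_ege1.
Qed.

(** * Tilting at the bottleneck *)

(** Trades the [l]-th power of a growth factor for the linear loss [l * x]. *)
Lemma expr_mul_le1 (R : realFieldType) (x : R) l :
  0 <= x -> (1 + x) ^+ l * (1 - l%:R * x) <= 1.
Proof.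
move=> x0; elim: l => [|l IHl]; first by rewrite mul0r subr0 mulr1.
apply: le_trans IHl; rewrite exprSr -mulrA ler_wpM2l ?exprn_ge0 ?addr_ge0 //.
rewrite -natr1; have : 0 <= (l%:R + 1) * x ^+ 2 by rewrite mulr_ge0 ?sqr_ge0 ?addr_ge0.
by lra.
Qed.

Lemma lez_of_absz (k : nat) (z : int) : 0 <= z -> (k < `|z|)%N -> k%:Z <= z.
Proof. by lia. Qed.

Section Bottleneck.
Variables (R : realType) (d : nat) (lam mu : 'I_d -> R) (P : 'M[R]_d) (i : 'I_d).
Hypotheses (lam_ge0 : forall j, 0 <= lam j) (mu_gt0 : forall j, 0 < mu j).
Hypotheses (P_ge0 : forall j k, 0 <= P j k).
Hypothesis P_sub : forall j, \sum_(k < d) P j k <= 1.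
Hypothesis irr : irreducible_q lam mu P.
Variable nu : 'I_d -> R.
Hypotheses (nuP : traffic lam P nu) (nu_lt_mu : forall j, nu j < mu j).

Local Notation space := 'rV[int]_d.
Local Notation T := (jump_op (event_rate lam mu P i) (@event_shift d)).
Local Notation K := (jump_ker (event_rate lam mu P i) (@event_shift d)).
Local Notation G := (Gmx P).
Local Notation L := (Lam lam mu).

Let A := Num.sqrt (mu i).
Let V := Num.sqrt (nu i).
Let g := G i i.

Let nu_gt0 j : 0 < nu j.
Proof. exact: (traffic_gt0 lam_ge0 mu_gt0 P_ge0 P_sub irr nuP). Qed.
Let G_ge0 j k : 0 <= G j k.
Proof. exact: (Gmx_ge0 lam_ge0 mu_gt0 P_ge0 P_sub irr). Qed.
Let G_gt0 j : 0 < G j j.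
Proof. exact: (Gmx_diag_gt0 lam_ge0 mu_gt0 P_ge0 P_sub irr). Qed.
Let g_gt0 : 0 < g. Proof. exact: G_gt0. Qed.
Let A_gt0 : 0 < A. Proof. by rewrite sqrtr_gt0. Qed.
Let V_gt0 : 0 < V. Proof. by rewrite sqrtr_gt0. Qed.
Let muE : mu i = A ^+ 2. Proof. by rewrite sqr_sqrtr // ltW. Qed.
Let nuE : nu i = V ^+ 2. Proof. by rewrite sqr_sqrtr // ltW. Qed.
Let V_lt_A : V < A. Proof. by rewrite ltr_sqrt. Qed.
Let g_neq0 : g != 0. Proof. by rewrite gt_eqF. Qed.
Let V_neq0 : V != 0. Proof. by rewrite gt_eqF. Qed.
Let A_neq0 : A != 0. Proof. by rewrite gt_eqF. Qed.

(** [G j i / g] is the probability of ever visiting [i] from [j]: this is the harmonic interpolation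
    between [A / V] at [i] and [1] at the exterior. *)
Definition tilt (j : 'I_d) : R := 1 + (A / V - 1) * (G j i / g).

(** Solves the traffic equations away from [i] with flow [t * A * V] at [i]; [G i j / g] is the mean
    number of visits to [j] per visit to [i], for a customer started at [i]. *)
Definition throughput (t : R) (j : 'I_d) : R := nu j + (t * A * V - nu i) * (G i j / g).

Lemma tilt_i : tilt i = A / V.
Proof. by rewrite /tilt -/g divff // mulr1 addrC subrK. Qed.

Lemma throughput_i t : throughput t i = t * A * V.
Proof. by rewrite /throughput -/g divff // mulr1 addrC subrK. Qed.

Lemma tilt_bounds j : 1 <= tilt j <= A / V.
Proof.
have AV : 0 <= A / V - 1 by rewrite subr_ge0 ler_pdivlMr // mul1r ltW.
rewrite /tilt lerDl mulr_ge0 ?divr_ge0 ?(ltW g_gt0) //= addrC -lerBrDr.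
rewrite ler_piMr // ler_pdivrMr // mul1r.
exact: (Gmx_le_diag lam_ge0 mu_gt0 P_ge0 P_sub irr).
Qed.

Lemma tilt_gt0 j : 0 < tilt j.
Proof. by have /andP[/(lt_le_trans ltr01)] := tilt_bounds j. Qed.

Let sum_hit j : \sum_k P j k * (G k i / g) = (G j i - (j == i)%:R) / g.
Proof.
rewrite (Gmx_recl lam_ge0 mu_gt0 P_ge0 P_sub irr j i) addrC addKr mulr_suml.
by apply: eq_bigr => k _; rewrite mulrA.
Qed.

Let sum_visits k : \sum_j (G i j / g) * P j k = (G i k - (i == k)%:R) / g.
Proof.
rewrite (Gmx_recr lam_ge0 mu_gt0 P_ge0 P_sub irr i k) addrC addKr mulr_suml.
by apply: eq_bigr => j _; rewrite mulrAC.
Qed.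

Let route_tilt j : p0 P j + \sum_k P j k * tilt k
  = 1 + (A / V - 1) * ((G j i - (j == i)%:R) / g).
Proof.
rewrite -sum_hit mulr_sumr /p0 addrAC -addrA -sumrB; congr (_ + _).
by apply: eq_bigr => k _; rewrite /tilt; ring.
Qed.

(** Eigenvalue of [tilt] at [t = 1], and of the measure with parameter [t]. Because of [t + t^-1],
    moving [t] off [1] by [de] costs only order [de ^+ 2]. *)
Definition growth (t : R) : R := L - (A ^+ 2 + V ^+ 2 - A * V * (t + t^-1)) / g.

Lemma iter_tilt N (x : space) :
  iter N T (monomial tilt) x = growth 1 ^+ N * monomial tilt x.
Proof.
rewrite iter_monomial_eigen //; first last.
- by move=> j ji; rewrite route_tilt (negbTE ji) subr0.
- exact: tilt_gt0.
congr (_ ^+ N * _); rewrite route_tilt eqxx -/g tilt_i.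
have -> : \sum_j lam j * tilt j = \sum_j lam j + (A / V - 1) / g * nu i.
  rewrite (trafficE lam_ge0 mu_gt0 P_ge0 P_sub irr nuP i) mulr_sumr -big_split.
  by apply: eq_bigr => j _; rewrite /tilt /=; ring.
rewrite /growth /Lam big_split /= [X in _ + X - _](bigD1 i) //= muE nuE.
rewrite mulr1n; field; rewrite ?A_neq0 ?V_neq0 ?g_neq0 //.
Qed.

(** By [traffic_through], [nu j] dominates the flow that comes through [i]; what remains is
    nonnegative. *)
Lemma throughput_gt0 t j : 0 < t -> 0 < throughput t j.
Proof.
move=> t0; set v := G i j / g.
have le_nu : nu i * v <= nu j.
  rewrite mulrA ler_pdivrMr //.
  exact: (traffic_through lam_ge0 mu_gt0 P_ge0 P_sub irr nuP).
have v_ge0 : 0 <= v by rewrite divr_ge0 // ltW.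
have -> : throughput t j = nu j - nu i * v + t * A * V * v by rewrite /throughput -/v; ring.
have [v0|v_neq0] := eqVneq v 0; first by rewrite v0 !mulr0 subr0 addr0.
have v_gt0 : 0 < v by rewrite lt_neqAle eq_sym v_neq0.
by apply: ltr_wpDl; [rewrite subr_ge0 | apply: mulr_gt0 => //; rewrite !mulr_gt0].
Qed.

Lemma free_ker_le_growth t n (y : space) : 0 < t ->
  K n 0 y <= growth t ^+ n * ((valid i y)%:R * monomial (fun j => throughput t j / mu j) y).
Proof.
move=> t0; have t_neq0 : t != 0 by rewrite gt_eqF.
have sum_thr k : \sum_j throughput t j * P j k
   = nu k - lam k + (t * A * V - nu i) * ((G i k - (i == k)%:R) / g).
  have -> : nu k - lam k = \sum_j nu j * P j k by rewrite [nu k]nuP addrAC subrr add0r.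
  rewrite -sum_visits mulr_sumr -big_split /=.
  by apply: eq_bigr => j _; rewrite /throughput; ring.
apply: le_trans (free_ker_le (u := throughput t) lam_ge0 mu_gt0 P_ge0 P_sub _ _ n y) _.
- by move=> j; exact: throughput_gt0.
- move=> k ki; rewrite sum_thr eq_sym (negbTE ki) /throughput /= subr0; ring.
rewrite le_eqVlt; apply/orP; left; apply/eqP; congr (_ ^+ n * _).
rewrite sum_thr eqxx -/g throughput_i.
(* Flow conservation: outflow is inflow plus the excess at [i], where the traffic equation is not
   imposed. *)
have -> : \sum_j throughput t j * p0 P j = \sum_k lam k + (t * A * V - nu i) / g.
  have -> : \sum_j throughput t j * p0 P j
      = \sum_k (throughput t k - \sum_j throughput t j * P j k).
    rewrite sumrB exchange_big -sumrB /=; apply: eq_bigr => j _.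
    by rewrite /p0 mulrBr mulr1 mulr_sumr.
  rewrite (eq_bigr (fun k => lam k + (t * A * V - nu i) * ((i == k)%:R / g))); last first.
    by move=> k _; rewrite sum_thr /throughput; ring.
  rewrite big_split /=; congr (_ + _).
  rewrite -mulr_sumr (bigD1 i) //= eqxx big1 ?addr0 ?mul1r //.
  by move=> k; rewrite eq_sym => /negbTE->; rewrite mul0r.
rewrite /growth /Lam big_split /= [X in _ = _ + X - _](bigD1 i) //= muE nuE.
rewrite mulr1n; field; rewrite ?A_neq0 ?V_neq0 ?g_neq0 ?t_neq0 //.
Qed.

Hypothesis bottleneck : forall j,
  (A - V) ^+ 2 / g <= (Num.sqrt (mu j) - Num.sqrt (nu j)) ^+ 2 / G j j.

(** Both sides are expanded from [b ^+ 2], with [mu j = (b + t) ^+ 2]. Minimality at [i] enters as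
    [st]; strictness comes from [Gmx_minor_gt0] in the last term. *)
Lemma throughput_tilt_lt j : j != i -> throughput 1 j * tilt j < mu j.
Proof.
move=> ji; set s := A - V; set t := Num.sqrt (mu j) - Num.sqrt (nu j).
set b := Num.sqrt (nu j); set g' := G j j; set p := G i j; set p' := G j i.
have b_gt0 : 0 < b by rewrite sqrtr_gt0.
have t_gt0 : 0 < t by rewrite subr_gt0 ltr_sqrt.
have s_gt0 : 0 < s by rewrite subr_gt0.
have g'_gt0 : 0 < g' by exact: G_gt0.
have nujE : nu j = b ^+ 2 by rewrite sqr_sqrtr // ltW.
have mujE : mu j = (b + t) ^+ 2 by rewrite /t addrC subrK sqr_sqrtr // ltW.
have st : s ^+ 2 * g' <= t ^+ 2 * g.
  by have := bottleneck j; rewrite ler_pdivrMr // mulrAC ler_pdivlMr.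
have pp' : p * p' < g * g'.
  by apply: (Gmx_minor_gt0 lam_ge0 mu_gt0 P_ge0 P_sub irr); rewrite eq_sym.
have p_nu : V ^+ 2 * p <= b ^+ 2 * g.
  rewrite -nuE -nujE; exact: (traffic_through lam_ge0 mu_gt0 P_ge0 P_sub irr nuP).
have p'_nu : b ^+ 2 * p' <= V ^+ 2 * g'.
  rewrite -nuE -nujE; exact: (traffic_through lam_ge0 mu_gt0 P_ge0 P_sub irr nuP).
have p_le : p <= g' by exact: (Gmx_le_diag lam_ge0 mu_gt0 P_ge0 P_sub irr).
have p'_le : p' <= g by exact: (Gmx_le_diag lam_ge0 mu_gt0 P_ge0 P_sub irr).
have p_ge0 : 0 <= p by exact: G_ge0.
have p'_ge0 : 0 <= p' by exact: G_ge0.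
pose X := V * s * p / g; pose Y := b ^+ 2 * s * p' / (V * g).
have prodE : throughput 1 j * tilt j = b ^+ 2 + X + Y + s ^+ 2 * (p * p') / g ^+ 2.
  rewrite /throughput /tilt nujE nuE -/p -/p' /X /Y.
  have -> : A = V + s by rewrite /s addrC subrK.
  by field; rewrite V_neq0 g_neq0.
have lt3 : s ^+ 2 * (p * p') / g ^+ 2 < t ^+ 2.
  rewrite ltr_pdivrMr ?exprn_gt0 //.
  apply: (@lt_le_trans _ _ (s ^+ 2 * (g * g'))); first by rewrite ltr_pM2l ?exprn_gt0.
  have -> : s ^+ 2 * (g * g') = s ^+ 2 * g' * g by ring.
  by rewrite expr2 [X in _ <= X]mulrA ler_pM2r.
have [b_ge0 t_ge0 s_ge0] : [/\ 0 <= b, 0 <= t & 0 <= s] by rewrite !ltW.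
have [V_ge0 g_ge0] : 0 <= V /\ 0 <= g by rewrite !ltW.
have s2 : 0 <= s ^+ 2 by rewrite exprn_ge0 // ltW.
(* Both cross terms are at most [b * t]. *)
have leX : X <= b * t.
  rewrite ler_pdivrMr // -ler_sqr ?nnegrE ?mulr_ge0 //.
  have -> : (V * s * p) ^+ 2 = s ^+ 2 * p * (V ^+ 2 * p) by ring.
  apply: (@le_trans _ _ (s ^+ 2 * g' * (b ^+ 2 * g))).
    apply: ler_pM => //; [exact: mulr_ge0 | by rewrite mulr_ge0 ?sqr_ge0 | exact: ler_wpM2l].
  have -> : (b * t * g) ^+ 2 = t ^+ 2 * g * (b ^+ 2 * g) by ring.
  by rewrite ler_wpM2r // mulr_ge0 ?exprn_ge0.
have leY : Y <= b * t.
  rewrite ler_pdivrMr ?mulr_gt0 // -ler_sqr ?nnegrE ?mulr_ge0 ?exprn_ge0 //.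
  have -> : (b ^+ 2 * s * p') ^+ 2 = b ^+ 2 * s ^+ 2 * (p' * (b ^+ 2 * p')) by ring.
  apply: (@le_trans _ _ (b ^+ 2 * s ^+ 2 * (g * (V ^+ 2 * g')))).
    apply: ler_wpM2l; first by rewrite mulr_ge0 ?sqr_ge0.
    by apply: ler_pM => //; rewrite mulr_ge0 ?sqr_ge0.
  have -> : b ^+ 2 * s ^+ 2 * (g * (V ^+ 2 * g')) = s ^+ 2 * g' * (b ^+ 2 * V ^+ 2 * g) by ring.
  have -> : (b * t * (V * g)) ^+ 2 = t ^+ 2 * g * (b ^+ 2 * V ^+ 2 * g) by ring.
  by rewrite ler_wpM2r // !mulr_ge0 ?exprn_ge0.
rewrite prodE mujE.
have -> : (b + t) ^+ 2 = b ^+ 2 + b * t + b * t + t ^+ 2 by ring.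
by lra.
Qed.
Let growthE t : t != 0 -> growth t = growth 1 + A * V / g * ((t - 1) ^+ 2 / t).
Proof. by move=> t0; rewrite /growth; field; rewrite t0 g_neq0. Qed.

Lemma growth1E : growth 1 = L - (A - V) ^+ 2 / g.
Proof. by rewrite /growth; field. Qed.

Lemma weighted_ker_le t n y (b : R) : 0 < t -> valid i y -> 0 <= growth t ->
  monomial (fun j => throughput t j / mu j * tilt j) y <= b ->
  monomial tilt y * K n 0 y <= growth t ^+ n * b.
Proof.
move=> t0 vy gt_ge0 yb; rewrite mulrC.
apply: le_trans (_ : _ <= growth t ^+ n * (1 * monomial (fun j => throughput t j / mu j) y)
                            * monomial tilt y) _.
  have := free_ker_le_growth n y t0; rewrite vy => Kle.
  by rewrite ler_wpM2r // ltW // monomial_gt0 //; exact: tilt_gt0.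
by rewrite mul1r -mulrA monomialM ler_wpM2l ?exprn_ge0.
Qed.

Lemma no_exponential_decay th : (A - V) ^+ 2 / g < th -> th < L ->
  ~ (forall n, K n 0 0 <= (L - th) ^+ n).
Proof.
move=> c_th th_L; set r := L - th => Kr.
have r_gt0 : 0 < r by rewrite subr_gt0.
set E1 := growth 1; have r_lt_E1 : r < E1 by rewrite /E1 growth1E /r; lra.
have E1_gt0 : 0 < E1 by apply: lt_trans r_lt_E1.
have [c [c_gt0 c_le1 cP]] := free_ker_le_return lam_ge0 mu_gt0 P_ge0 P_sub irr r_gt0 Kr.
(* Factor per unit of norm in the ball: [A / V] bounds the tilt and [c^-1] the return path. *)
pose B := A / V / c.
have AV_ge1 : 1 <= A / V by rewrite ler_pdivlMr // mul1r ltW.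
have B_ge1 : 1 <= B by rewrite ler_pdivlMr // mul1r (le_trans c_le1).
have B_gt0 : 0 < B by apply: lt_le_trans B_ge1.
(* With [l * k] steps for radius [k], the decay [(r / E1) ^+ (l * k)] beats the cost
   [B ^+ (d * k)]. *)
have [l ql] : exists l, (r / E1) ^+ l * B ^+ d < 1.
  apply: contrapT => H.
  have : E1 / r <= 1.
    apply: (@expr_bounded_le1 _ _ (B ^+ d)) => l.
    rewrite leNgt; apply/negP => Bl; apply: H; exists l.
    by rewrite -[X in X ^+ l]invf_div exprVn ltr_pdivrMl ?mulr1 ?exprn_gt0 ?divr_gt0.
  by rewrite ler_pdivrMr // mul1r leNgt r_lt_E1.
pose C := A * V / (g * E1).
have C_gt0 : 0 < C by rewrite divr_gt0 ?mulr_gt0.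
pose f t j := throughput t j / mu j * tilt j.
have f_gt0 t j : 0 < t -> 0 < f t j.
  by move=> t0; rewrite mulr_gt0 ?tilt_gt0 // divr_gt0 // throughput_gt0.
have f1_lt j : j != i -> f 1 j < 1.
  by move=> /throughput_tilt_lt; rewrite /f mulrAC ltr_pdivrMr // mul1r.
pose s j := A * V * (G i j / g) / mu j * tilt j.
have fE t j : f t j = f 1 j + (t - 1) * s j by rewrite /f /s /throughput; ring.
have fi t : f t i = t.
  rewrite /f throughput_i tilt_i muE; field; by rewrite A_neq0 V_neq0.
have s_ge0 j : 0 <= s j.
  by rewrite !mulr_ge0 ?invr_ge0 ?(ltW A_gt0) ?(ltW V_gt0) ?(ltW g_gt0) ?(ltW (mu_gt0 _)) ?(ltW (tilt_gt0 _)).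
(* The first term gives [l * x <= de / 4] below, the summand [2] gives [de <= 1 / 2]. *)
pose D := 8%:R * C * l%:R + 2%:R.
have D_ge2 : 2%:R <= D by rewrite lerDr mulr_ge0 // mulr_ge0 // ltW.
(* The second minimum keeps [f t j <= 1] for [j != i] up to [t = 1 + de]; the added [1] avoids a
   zero denominator when the slope [s j] vanishes. *)
pose de := Num.min D^-1 (\big[Num.min/1]_(j | j != i) ((1 - f 1 j) / (s j + 1))).
have de_gt0 : 0 < de.
  rewrite lt_min invr_gt0 (lt_le_trans _ D_ge2) //=; apply: lt_bigmin => // j ji.
  by rewrite divr_gt0 ?subr_gt0 ?f1_lt // ltr_wpDl.
have deD : de * D <= 1.
  by rewrite -ler_pdivlMr ?(lt_le_trans _ D_ge2) // mul1r ge_min lexx.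
have de_half : de * 2%:R <= 1 by apply: le_trans deD; rewrite ler_wpM2l // ltW.
have f_le1 t j : j != i -> t <= 1 + de -> f t j <= 1.
  move=> ji t_de; rewrite fE.
  have sde : de * (s j + 1) <= 1 - f 1 j.
    by rewrite -ler_pdivlMr ?ltr_wpDl // ge_min bigmin_le_cond ?orbT.
  have : (t - 1) * s j <= de * s j by rewrite ler_wpM2r // lerBlDl.
  by lra.
(* Bounds the relative growth at [t = 1 - de] and [t = 1 + de], where [t^-1 <= 2]. *)
pose x := 2%:R * C * de ^+ 2.
have x_ge0 : 0 <= x by rewrite mulr_ge0 ?sqr_ge0 // mulr_ge0 // ltW.
have growth_de t : 0 < t -> (t - 1) ^+ 2 = de ^+ 2 -> 1 <= 2%:R * t ->
    0 <= growth t <= E1 * (1 + x).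
  move=> t0 tde t2; rewrite growthE ?gt_eqF // tde -/E1.
  have -> : A * V / g = E1 * C by rewrite /C; field; rewrite g_neq0 gt_eqF.
  have dt0 : 0 <= de ^+ 2 / t by rewrite divr_ge0 ?sqr_ge0 // ltW.
  have EC : 0 < E1 * C by rewrite mulr_gt0.
  have g0 : 0 <= E1 + E1 * C * (de ^+ 2 / t) by rewrite addr_ge0 ?(ltW E1_gt0) // mulr_ge0 // ltW.
  rewrite g0 /=.
  have u_le : de ^+ 2 / t <= 2%:R * de ^+ 2.
    by rewrite ler_pdivrMr // mulrAC ler_peMl ?sqr_ge0.
  have := ler_wpM2l (ltW EC) u_le; rewrite /x => ?; lra.
(* The Chernoff gain is of first order in [de] and the growth of second order, so [X * (1 - de)] and
   [X / (1 + de)] fall below [1]. *)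
have xl : (1 + x) ^+ l * (1 - de / 4%:R) <= 1.
  apply: le_trans (expr_mul_le1 l x_ge0); rewrite ler_wpM2l ?exprn_ge0 ?addr_ge0 //.
  rewrite lerD2l lerN2 /x; have : de * (de * D) <= de * 1 by rewrite ler_wpM2l // ltW.
  by have := sqr_ge0 de; rewrite /D; lra.
pose X := (1 + x) ^+ l.
have X_gt0 : 0 < X by rewrite exprn_gt0 // ltr_wpDr.
(* Decay rates: [q1] inside the ball, [q2] where a queue [j <> i] is long, [q3] and [q4]
   where coordinate [i] is large and positive, resp. negative. *)
pose q1 := (r / E1) ^+ l * B ^+ d.
pose q2 := \big[Num.max/0]_(j | j != i) f 1 j.
pose q3 := X * (1 - de).
pose q4 := X / (1 + de).
pose q := Num.max (Num.max q1 q2) (Num.max q3 q4).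
have q1_gt0 : 0 < q1 by rewrite mulr_gt0 ?exprn_gt0 ?divr_gt0.
have q_gt0 : 0 < q by rewrite !lt_max q1_gt0.
have q_lt1 : q < 1.
  rewrite !gt_max ql /=; apply/and3P; split.
  - by apply: bigmax_lt => // j ji; exact: f1_lt.
  - rewrite /q3; rewrite -/X in xl; nra.
  - rewrite /q4 ltr_pdivrMr ?addr_gt0 // mul1r; rewrite -/X in xl; nra.
(* The box reached in [N = l * k] steps has side [l.*2 * k + 1]. *)
have [k kq] := polynomial_geometric_lt1 l.*2 d q_gt0 q_lt1.
pose N := (l * k)%N.
have le_q z : 0 <= z -> z <= q -> E1 ^+ N * z ^+ k <= E1 ^+ N * q ^+ k.
  move=> z0 zq; rewrite ler_wpM2l ?exprn_ge0 ?(ltW E1_gt0) //.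
  by rewrite lerXn2r ?nnegrE ?(ltW q_gt0).
have growth_pow (u : R) : 0 <= growth u <= E1 * (1 + x) -> growth u ^+ N <= E1 ^+ N * X ^+ k.
  move=> /andP[u0 uE]; rewrite -exprM -exprMn lerXn2r ?nnegrE //.
  by rewrite mulr_ge0 ?(ltW E1_gt0) ?addr_ge0.
have pointwise y : monomial tilt y * K N 0 y <= E1 ^+ N * q ^+ k.
  have tilt_ge0 : 0 <= monomial tilt y by rewrite ltW // monomial_gt0 //; exact: tilt_gt0.
  have [vy|nvy] := boolP (valid i y); last first.
    apply: le_trans (_ : monomial tilt y * 0 <= _); last first.
      by rewrite mulr0 mulr_ge0 ?exprn_ge0 // ltW.
    rewrite ler_wpM2l //; have := free_ker_le_growth N y ltr01.
    by rewrite (negbTE nvy) mul0r mulr0.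
  have [/forallP small|] := boolP [forall j, (`|y 0%R j| <= k)%N].
    apply: le_trans (le_q q1 (ltW q1_gt0) _); last by rewrite !le_max lexx.
    have norm_le : (norm1 y <= d * k)%N.
      rewrite -[d in leqRHS]card_ord -sum_nat_const; exact: leq_sum.
    apply: le_trans (_ : _ <= r ^+ N * B ^+ norm1 y) _; last first.
      have -> : E1 ^+ N * q1 ^+ k = r ^+ N * B ^+ (d * k).
        rewrite [q1 ^+ k]exprMn -!exprM expr_div_n mulrA [E1 ^+ N * _]mulrC.
        by rewrite divfK ?expf_neq0 ?gt_eqF.
      by rewrite ler_wpM2l ?exprn_ge0 ?(ltW r_gt0) // ler_weXn2l.
    rewrite /B exprMn mulrCA ler_pM ?cP //; last exact: (monomial_le_norm1 y tilt_bounds).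
    by rewrite jump_ker_ge0 //; exact: event_rate_ge0.
  rewrite negb_forall => /existsP[j]; rewrite -ltnNge => yj.
  have others (u : R) z : 0 < u -> u <= 1 + de -> z != i -> f u z ^ y 0 z <= 1.
    move=> u0 ude zi; apply: (exprz_le_expr (k := 0) (f_gt0 u z u0)).
      exact: f_le1.
    exact: (validP _ _ vy).
  (* Since [f t i = t], the value [1 - de] penalises a large positive coordinate [i] and [1 + de] a
     large negative one. *)
  have [ji|ji] := eqVneq j i.
    subst j; have [yi|yi] := leP 0 (y 0 i).
      have de0 : 0 < 1 - de by lra.
      have gr : 0 <= growth (1 - de) <= E1 * (1 + x).
        by apply: growth_de => //; [ring | lra].
      apply: le_trans (weighted_ker_le N de0 vy _ _) _; [by case/andP: gr | | ].
        apply: (monomial_le (j := i) (b := (1 - de) ^+ k)) => [z|z zi|].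
        - exact: f_gt0.
        - by apply: others => //; lra.
        - rewrite -/(f _ i) fi; apply: exprz_le_expr => //; first by lra.
          exact: lez_of_absz.
      apply: le_trans (le_q q3 _ _); last 2 first.
      - by rewrite mulr_ge0 ?ltW.
      - by rewrite !le_max lexx ?orbT.
      by rewrite [q3 ^+ k]exprMn mulrA ler_wpM2r ?growth_pow ?exprn_ge0 ?(ltW de0).
    have de0 : 0 < 1 + de by lra.
    have gr : 0 <= growth (1 + de) <= E1 * (1 + x).
      by apply: growth_de => //; [ring | lra].
    apply: le_trans (weighted_ker_le N de0 vy _ _) _; [by case/andP: gr | | ].
      apply: (monomial_le (j := i) (b := (1 + de)^-1 ^+ k)) => [z|z zi|].
      - exact: f_gt0.
      - by apply: others.
      - rewrite -/(f _ i) fi -[y 0 i]opprK -exprz_inv.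
        apply: exprz_le_expr; first by rewrite invr_gt0.
          by rewrite invf_le1 // lerDl ltW.
        by apply: lez_of_absz; rewrite ?abszN // oppr_ge0 ltW.
    apply: le_trans (le_q q4 _ _); last 2 first.
    - by rewrite divr_ge0 ?ltW.
    - by rewrite !le_max lexx ?orbT.
    by rewrite [q4 ^+ k]exprMn mulrA ler_wpM2r ?growth_pow ?exprn_ge0 ?invr_ge0 ?(ltW de0).
  (* At [t = 1] coordinate [i] has factor [1] whatever its sign, and the long queue [j] provides the
     decay. *)
  have q2_ge0 : 0 <= q2 by apply: bigmax_ge_id.
  apply: le_trans (le_q q2 q2_ge0 _); last by rewrite !le_max lexx ?orbT.
  apply: weighted_ker_le => //; first exact: ltW.
  apply: (monomial_le (j := j)) => [z|z zj|].
  - exact: f_gt0.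
  - have [->|zi] := eqVneq z i; first by rewrite -/(f _ i) fi exp1rz.
    by apply: others => //; lra.
  apply: le_trans (_ : f 1 j ^+ k <= _).
    apply: exprz_le_expr; [exact: f_gt0 | exact/ltW/f1_lt |].
    by apply: lez_of_absz => //; exact: (validP _ _ vy).
  rewrite lerXn2r ?nnegrE ?(ltW (f_gt0 _ _ _)) //.
  exact: le_bigmax_cond.
(* The tilted mass after [N] steps is exactly [E1 ^+ N], all of it in the box. *)
have : E1 ^+ N <= \sum_(y <- box d N) E1 ^+ N * q ^+ k.
  have := iter_tilt N 0; rewrite monomial0 mulr1 iter_jump_box => sumE.
  rewrite -[X in X <= _]sumE.
  by apply: ler_sum => y _; exact: pointwise.
rewrite big_const_seq count_predT size_box iter_addr_0 -mulrnAr.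
rewrite -[X in X <= _]mulr1 ler_pM2l ?exprn_gt0 // leNgt => /negP; apply.
by rewrite -mulr_natl natrX /N doubleMl.
Qed.
End Bottleneck.

(** * Passage to the essential spectral radius *)

Unset Implicit Arguments.

Theorem theorem2p3 (R : realType) (n : nat)
    (lam mu : 'I_n.+1 -> R) (P : 'M[R]_n.+1) (nu : 'I_n.+1 -> R) :
  (forall i, 0 <= lam i) ->
  (forall i, 0 < mu i) ->
  (forall i j, 0 <= P i j) ->
  (forall i, P i i = 0) ->
  (forall i, \sum_(j < n.+1) P i j <= 1) ->
  (* hypothesis (A) *)
  irreducible_q lam mu P ->
  (* nu solves the traffic equations *)
  traffic lam P nu ->
  (* hypothesis (B) *)
  (forall i, nu i < mu i) ->
  ((- \big[Order.min/ ((Num.sqrt (mu ord0) - Num.sqrt (nu ord0)) ^+ 2 / Gmx P ord0 ord0)]_(i < n.+1)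
        ((Num.sqrt (mu i) - Num.sqrt (nu i)) ^+ 2 / Gmx P i i))%:E
    <= lne (ess_spec_radius lam mu P))%E.
Proof.
move=> lam_ge0 mu_gt0 P_ge0 P_diag P_sub irr nuP nu_lt_mu.
pose c i := (Num.sqrt (mu i) - Num.sqrt (nu i)) ^+ 2 / Gmx P i i.
have [i _ cmin] := @arg_minP _ R _ ord0 predT c isT.
have bottleneck j : c i <= c j by exact: cmin.
(* The default of the minimum is [c ord0], itself one of the values. *)
rewrite -/(c ord0) [\big[_/_]_(_ < _) _](_ : _ = c i); last first.
  by apply/le_anti; rewrite bigmin_le le_bigmin.
have nu_gt0 j : 0 < nu j by exact: (traffic_gt0 lam_ge0 mu_gt0 P_ge0 P_sub irr nuP).
(* Leaves room for a [th] between [c i] and [Lam], as the gamma integral requires. *)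
have c_lt_L : c i < Lam lam mu.
  have g1 := Gmx_diag_ge1 lam_ge0 mu_gt0 P_ge0 P_sub irr i.
  have V0 : 0 < Num.sqrt (nu i) by rewrite sqrtr_gt0.
  have VA : Num.sqrt (nu i) < Num.sqrt (mu i) by rewrite ltr_sqrt.
  apply: (@lt_le_trans _ _ (mu i)).
    rewrite ltr_pdivrMr ?(lt_le_trans ltr01 g1) //.
    apply: (@lt_le_trans _ _ (mu i)); last by rewrite ler_peMr // ltW.
    by rewrite -[ltRHS]sqr_sqrtr ?(ltW (mu_gt0 i)) //; nra.
  rewrite /Lam (bigD1 i) //= -addrA addrCA lerDl addr_ge0 //.
  by apply: sumr_ge0 => j _; rewrite addr_ge0 // ltW.
have ess_ge r : ess_set lam mu P r -> expR (- c i) <= r.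
  move=> ess_r; have r_gt0 : 0 < r by case: ess_r.
  rewrite leNgt; apply/negP => r_lt.
  have c_lt : c i < - ln r.
    by rewrite ltrNr -ltr_expR lnK // posrE.
  (* Capping at [Lam] keeps [th] admissible for very small [r]. *)
  pose m := Num.min (- ln r) (Lam lam mu).
  have c_lt_m : c i < m by rewrite lt_min c_lt.
  have m_le : m <= - ln r by rewrite ge_min lexx.
  have m_le_L : m <= Lam lam mu by rewrite ge_min lexx orbT.
  pose th := (c i + m) / 2%:R.
  have th_L : th < Lam lam mu by rewrite /th; lra.
  have r_th : r <= expR (- th).
    by rewrite -[leLHS]lnK ?posrE // ler_expR /th; lra.
  have := free_ker_return i lam_ge0 mu_gt0 P_ge0 P_diag P_sub r_gt0 r_th th_L ess_r.
  apply: (no_exponential_decay lam_ge0 mu_gt0 P_ge0 P_sub irr nuP nu_lt_mu bottleneck) => //.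
  by rewrite -/(c i) /th; lra.
have le_inf : ((expR (- c i))%:E <= ess_spec_radius lam mu P)%E.
  by apply: le_ereal_inf_tmp => _ [r ess_r <-]; rewrite lee_fin ess_ge.
have -> : (- c i)%:E = lne (expR (- c i))%:E by rewrite lne_EFin ?expR_gt0 // expRK.
rewrite lee_lne // in_itv /= leey ?andbT ?lee_fin ?expR_ge0 //.
by rewrite (le_trans _ le_inf) // lee_fin expR_ge0.
Qed.
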